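(* Let $C\subset\mathbb{R}^n$ be an open convex cone and let $p,q\in\mathbb{R}[x_1,\dots,x_n]$ be homogeneous coprime polynomials that are positive on $C$ and such that $f=(q/p)^{\alpha}$ is completely monotone on $C$ for some $\alpha>0$. Then $p$ is hyperbolic and its hyperbolicity cone contains $C$.
   Context: A smooth function $f:C\to\mathbb{R}$ on an open convex cone $C\subset\mathbb{R}^n$ is completely monotone if $(-1)^r D_{v_1}\cdots D_{v_r}f(x)\ge0$ for all $r\ge0$, all $v_1,\dots,v_r\in C$ and all $x\in C$, where $D_v$ denotes the directional derivative along $v$. A homogeneous polynomial $p\in\mathbb{R}[x_1,\dots,x_n]$ is hyperbolic with respect to $e\in\mathbb{R}^n$ if $p(e)>0$ and, for every $x\in\mathbb{R}^n$, the univariate polynomial $t\mapsto p(te+x)$ has only real zeros. The connected component of $\{x\in\mathbb{R}^n:p(x)\neq0\}$ containing $e$ is then an open convex cone, called the hyperbolicity cone of $p$ (containing $e$), and $p$ is hyperbolic with respect to each of its vectors. *)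

(* Defs.v *)
From mathcomp Require Import all_boot all_order all_algebra.
From mathcomp Require Import complex.
(* mpoly's notations clash with those of MathComp-Analysis: [mpoly n R] is
   {mpoly R[n]}, [meval v p] is p.@[v], and [ishomog mdeg] is the predicate of
   polynomials all of whose monomials have the same total degree. *)
From mathcomp Require Import -(notations) mpoly.
From mathcomp Require Import all_classical all_reals all_analysis.

Set Implicit Arguments.
Unset Strict Implicit.
Unset Printing Implicit Defensive.

Import Order.TTheory GRing.Theory Num.Theory.
Import numFieldNormedType.Exports.

Local Open Scope classical_set_scope.
Local Open Scope ring_scope.

(* Nonempty: the empty set is not regarded as a cone. *)
Definition open_convex_cone (R : realType) (n : nat) (C : set 'rV[R]_n) : Prop :=
  [/\ C !=set0, open C, convex_set C &
      forall (t : R) x, 0 < t -> C x -> C (t *: x)].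

(* [iter_derive [:: v1; ...; vr] f] is D_{v1} (... (D_{vr} f)). *)
Definition iter_derive (R : realType) (n : nat) (vs : seq 'rV[R]_n)
    (f : 'rV[R]_n -> R) : 'rV[R]_n -> R :=
  foldr (fun v g => (fun x => 'D_v g x)) f vs.

(* On an open set C this is C^oo: Fréchet differentiability of every iterated
   directional derivative makes all of them exist and be continuous on C. The
   values of f outside C are irrelevant. *)
Definition smooth_on (R : realType) (n : nat) (C : set 'rV[R]_n)
    (f : 'rV[R]_n -> R) : Prop :=
  forall (vs : seq 'rV[R]_n) x, C x -> differentiable (iter_derive vs f) x.

Definition completely_monotone (R : realType) (n : nat) (C : set 'rV[R]_n)
    (f : 'rV[R]_n -> R) : Prop :=
  smooth_on C f /\
  forall vs : seq 'rV[R]_n, (forall v, v \in vs -> C v) ->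
  forall x, C x -> 0 <= (-1) ^+ size vs * iter_derive vs f x.

Definition peval (R : realType) (n : nat) (p : mpoly n R) (x : 'rV[R]_n) : R :=
  meval (x ord0) p.

Definition mpoly_coprime (R : realType) (n : nat) (p q : mpoly n R) : Prop :=
  forall g a b : mpoly n R, p = g * a -> q = g * b -> g \is a GRing.unit.

(* The univariate polynomial t |-> p(t e + x). *)
Definition line_poly (R : realType) (n : nat) (p : mpoly n R)
    (e x : 'rV[R]_n) : {poly R} :=
  mmap polyC (fun i => e ord0 i *: 'X + (x ord0 i)%:P) p.

Lemma horner_line_poly (R : realType) (n : nat) (p : mpoly n R)
    (e x : 'rV[R]_n) (t : R) :
  (line_poly p e x).[t] = peval p (t *: e + x).
Proof.
rewrite /line_poly /peval /meval /mmap horner_sum; apply: eq_bigr => m _.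
rewrite hornerM hornerC /mmap1 horner_prod; congr (_ * _).
by apply: eq_bigr => i _; rewrite horner_exp !hornerE !mxE mulrC.
Qed.

Definition only_real_zeros (R : realType) (P : {poly R}) : Prop :=
  forall z : R[i], root (map_poly (real_complex R) P) z -> complex.Im z = 0.

Definition hyperbolic (R : realType) (n : nat) (p : mpoly n R)
    (e : 'rV[R]_n) : Prop :=
  [/\ p \is ishomog mdeg, 0 < peval p e &
      forall x, only_real_zeros (line_poly p e x)].

Definition hyperbolicity_cone (R : realType) (n : nat) (p : mpoly n R)
    (e : 'rV[R]_n) : set 'rV[R]_n :=
  connected_component [set x | peval p x != 0] e.

(* Main.v *)
Require Import Defs.
From HB Require Import structures.
From mathcomp Require Import all_boot all_order all_algebra.
From mathcomp Require Import complex.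
From mathcomp Require Import -(notations) mpoly.
From mathcomp Require Import all_classical all_reals all_analysis.
From mathcomp Require Import ring lra zify.
Import Order.TTheory GRing.Theory Num.Theory.
Import numFieldNormedType.Exports.
Local Open Scope classical_set_scope.
Local Open Scope ring_scope.

Set Implicit Arguments.
Unset Strict Implicit.
Unset Printing Implicit Defensive.

(* Complete monotonicity at a point E of C bounds every mixed Taylor coefficient
   of f along two cone directions w, w' by that of the real direction w + w',
   and the Taylor series of f along - (w + w') converges up to the boundary of C
   because all its terms are nonnegative. Hence for complex z with modulus
   slightly below the real radius, the formal series b(u) of
   f(E + u (z w + z^* w')) has radius of convergence > 1, and E, w, w', z can be
   chosen so that this complex line meets any prescribed point e + i y, e in C.

   On the line, b solves P Q b' = alpha (P Q' - P' Q) b, where P and Q are the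
   restrictions of p and q. At a zero of P that is not a zero of Q the local
   exponent is negative, so b must vanish there; dividing by a Blaschke factor
   keeps the l^2 norm of the coefficients and lowers the exponent further, so
   this repeats forever and forces b(0) = 0, which is absurd. Thus every zero of
   p in C + i R^n is a zero of q.

   Since the polynomial ring is factorial, p and q have no common root on a
   generic line t |-> t e + x; there p has only real zeros by homogeneity, and
   this property is closed under limits in x. *)

(** * Factoriality of polynomial rings *)

Definition divides (D : idomainType) (a b : D) := exists c, b = c * a.

Definition prime_elt (D : idomainType) (x : D) :=
  [/\ x != 0, x \isn't a GRing.unit &
      forall a b, divides x (a * b) -> divides x a \/ divides x b].

Definition factorial_domain (D : idomainType) :=
  forall x : D, x != 0 -> exists (u : D) (s : seq D),
    [/\ u \is a GRing.unit, forall y, y \in s -> prime_elt y &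
        x = u * \prod_(y <- s) y].

Lemma divides_trans (D : idomainType) (b a c : D) :
  divides a b -> divides b c -> divides a c.
Proof. by move=> [x ->] [y ->]; exists (y * x); rewrite mulrA. Qed.

Lemma dividesD (D : idomainType) (a b c : D) :
  divides a b -> divides a c -> divides a (b + c).
Proof. by move=> [x ->] [y ->]; exists (x + y); rewrite mulrDl. Qed.

Lemma divides_mull (D : idomainType) (a b c : D) :
  divides a c -> divides a (b * c).
Proof. by move=> [x ->]; exists (b * x); rewrite mulrA. Qed.

Lemma divides_mulr (D : idomainType) (a b c : D) :
  divides a b -> divides a (b * c).
Proof. by rewrite mulrC; apply: divides_mull. Qed.

Lemma divides_polyC (D : idomainType) (a : D) (f : {poly D}) :
  divides a%:P f <-> forall i, divides a f`_i.
Proof.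
split=> [[g ->] i|]; first by exists g`_i; rewrite coefMC.
elim/poly_ind: f => [|f c IH] h; first by exists 0; rewrite mul0r.
have [|g ->] := IH; first by move=> i; have := h i.+1; rewrite coefD coefMX coefC /= addr0.
have := h 0; rewrite coefD coefMX coefC /= add0r => -[k ->].
by exists (g * 'X + k%:P); rewrite mulrDl polyCM mulrAC.
Qed.

Lemma divides_polyC_MX (D : idomainType) (a : D) (f : {poly D}) :
  divides a%:P (f * 'X) -> divides a%:P f.
Proof.
move=> /divides_polyC h; apply/divides_polyC => i.
by have := h i.+1; rewrite coefMX.
Qed.

(** Induction on the total size of the two factors. The prime divides the product of their constant
    terms, hence one of these; subtracting that constant term and cancelling ['X] leaves a smaller
    product. *)
Lemma prime_polyC (D : idomainType) (x : D) : prime_elt x -> prime_elt x%:P.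
Proof.
move=> [x0 xU xP]; split; first by rewrite polyC_eq0.
  by rewrite poly_unitE size_polyC coefC x0.
move=> f g; move: {2}(size f + size g)%N (leqnn (size f + size g)) => n.
elim: n f g => [|n IH] f g.
  rewrite leqn0 addn_eq0 !size_poly_eq0 => /andP[/eqP-> _] _; left.
  by exists 0; rewrite mul0r.
have main (f1 g1 : {poly D}) (c : D) :
    (size (f1 * 'X + c%:P)%R + size g1 <= n.+1)%N ->
    divides x c -> divides x%:P ((f1 * 'X + c%:P) * g1) ->
    divides x%:P (f1 * 'X + c%:P) \/ divides x%:P g1.
  move=> hs [k hk] [h hh].
  have dc : divides x%:P c%:P by exists k%:P; rewrite -polyCM -hk.
  have dfg : divides x%:P (f1 * g1).
    apply: divides_polyC_MX; exists (h - k%:P * g1).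
    by rewrite mulrBl -hh hk polyCM; ring.
  have [f10|f10] := eqVneq f1 0.
    by left; rewrite f10 mul0r add0r.
  case: (IH f1 g1) => //.
  - rewrite size_MXaddC (negPf f10) /= in hs.
    by rewrite -ltnS (leq_trans _ hs).
  - by move=> df; left; apply: dividesD => //; apply: divides_mulr.
  - by right.
elim/poly_ind: f => [|f c _]; first by move=> _ _; left; exists 0; rewrite mul0r.
elim/poly_ind: g => [|g d _]; first by move=> _ _; right; exists 0; rewrite mul0r.
move=> hs hd.
have : divides x (c * d).
  have /divides_polyC/(_ 0) := hd.
  by rewrite -!horner_coef0 !hornerE ?mulr0 ?add0r ?mulr0 ?add0r.
case/xP => hx; first exact: main.
rewrite addnC in hs; rewrite mulrC in hd.
by case: (main _ _ _ hs hx hd); [right | left].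
Qed.

(** Trivial content, tested prime by prime, which is the form that Gauss's lemma consumes. *)
Definition primitive (D : idomainType) (f : {poly D}) :=
  forall x, prime_elt x -> ~ divides x%:P f.

(** Gauss's lemma. The prime factors of [c] are cancelled one at a time: each stays prime as a
    constant polynomial and does not divide [f], so it divides [w]. *)
Lemma gauss_primitive (D : idomainType) (c : D) (f h w : {poly D}) :
  factorial_domain D -> c != 0 -> primitive f -> c *: h = w * f ->
  divides f h /\ divides c%:P w.
Proof.
move=> uD c0 fP; have [u [s [uU sP ->]]] := uD c c0.
elim: s sP h w => [|x s IH] sP h w.
  rewrite big_nil mulr1 => e; split.
    exists (u^-1 *: w); rewrite -scalerAl -e scalerA mulVr ?scale1r //.
  by exists (u^-1 *: w); rewrite [RHS]mulrC mul_polyC scalerA mulrV ?scale1r.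
rewrite big_cons mulrCA => e.
have xP : prime_elt x by apply: sP; rewrite inE eqxx.
have [x0 _ _] := xP.
have [_ _ xpr] := prime_polyC xP.
have [|[w' hw]|/(fP _ xP)//] := xpr w f.
  by rewrite -e; exists ((u * \prod_(y <- s) y) *: h); rewrite [RHS]mulrC mul_polyC scalerA.
have [||dfh [w'' hw'']] // := IH _ h w'.
- by move=> y ys; apply: sP; rewrite inE ys orbT.
- have xP0 : x%:P != 0 by rewrite polyC_eq0.
  apply: (mulfI xP0); rewrite mul_polyC scalerA e hw; ring.
split=> //; exists w''; rewrite hw hw'' polyCM; ring.
Qed.

Lemma divides_prime_prod (D : idomainType) (x u : D) (s : seq D) :
  prime_elt x -> u \is a GRing.unit -> divides x (u * \prod_(y <- s) y) ->
  exists2 y, y \in s & divides x y.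
Proof.
move=> [x0 xU xP] uU.
have uN : ~ divides x u.
  move=> [c hc]; move/negP: xU; apply; apply/unitrPr; exists (c / u).
  by rewrite mulrA (mulrC x) -hc divrr.
case/xP => // ; elim: s => [|y s IH].
  rewrite big_nil => -[c hc]; case: uN; exists (u * c).
  by rewrite -mulrA -hc mulr1.
rewrite big_cons => /xP[h|/IH[z zs hz]]; first by exists y; rewrite ?inE ?eqxx.
by exists z; rewrite ?inE ?zs ?orbT.
Qed.

Lemma prime_divides_prime (D : idomainType) (x y : D) :
  prime_elt x -> prime_elt y -> divides x y -> divides y x.
Proof.
move=> [x0 xU _] [y0 yU yP] [c hc].
case: (yP c x) => //; first by exists 1; rewrite mul1r hc.
move=> [d hd]; move/negP: xU; case; apply/unitrPr; exists d.
by apply: (mulIf y0); rewrite mul1r [RHS]hc hd; ring.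
Qed.

(** A prime dividing [f] divides its leading coefficient, so it is associated with one of the
    factors in [s]. Each extraction uses up one factor, and induction on their number terminates. *)
Lemma primitive_part (D : idomainType) (f : {poly D}) :
  factorial_domain D -> f != 0 ->
  exists (c : D) (g : {poly D}), [/\ c != 0, primitive g & f = c *: g].
Proof.
move=> uD f0; have [|u [s [uU]]] := uD (lead_coef f); first by rewrite lead_coef_eq0.
have [n] := ubnP (size s); elim: n => // n IH in f f0 s *.
rewrite ltnS => hs sP hl.
have [[x xs [g hg]]|np] := pselect (exists2 x, x \in s & divides x%:P f);
  last first.
  exists 1, f; split; rewrite ?oner_eq0 ?scale1r // => x xP hx.
  case: np; have [|||y ys dy] := @divides_prime_prod D x u s => //.
    by rewrite -hl lead_coefE; apply: (proj1 (divides_polyC _ _) hx).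
  exists y => //; apply: divides_trans hx.
  have [c ->] := prime_divides_prime xP (sP _ ys) dy.
  by exists c%:P; rewrite polyCM.
have [x0 _ _] := sP _ xs.
have g0 : g != 0 by apply: contraNneq f0 => e; rewrite hg e mul0r.
have [|||c [k [c0 kP hk]]] := IH g g0 (rem x s).
- by rewrite size_rem // (leq_trans _ hs) // prednK //; case: (s) xs.
- by move=> y /mem_rem; apply: sP.
- apply: (mulIf x0); move: hl; rewrite hg lead_coefM lead_coefC => ->.
  by rewrite (perm_big _ (perm_to_rem xs)) big_cons /= mulrCA mulrA [RHS]mulrC mulrA.
by exists (c * x), k; split; rewrite ?mulf_neq0 // hg hk mulrC mul_polyC scalerA mulrC.
Qed.

(** Over a domain [%|] is pseudo-divisibility, that is, divisibility over the fraction field. There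
    an irreducible polynomial is prime, and Gauss's lemma turns pseudo-divisibility by a primitive
    polynomial into genuine divisibility. *)
Lemma primitive_prime (D : idomainType) (f : {poly D}) :
  factorial_domain D -> primitive f -> irreducible_poly f -> prime_elt f.
Proof.
move=> uD fP [fs fI]; split.
- by rewrite -size_poly_gt0 ltnW.
- by rewrite poly_unitE; case: eqP fs => // ->.
have dv g : f %| g -> divides f g.
  by case/Pdiv.WeakIdomain.dvdpP => -[c w] /= c0 /(gauss_primitive uD c0 fP)[].
move=> a b [c hc].
have fab : f %| a * b by rewrite hc dvdp_mull.
have [/dv|fa] := boolP (f %| a); first by left.
right; apply: dv; rewrite -(@Gauss_dvdpr _ b a f) // /coprimep.
apply/negP => /negP g1; have := fI _ g1 (dvdp_gcdl _ _).
by move/eqp_dvdl => e; move: fa; rewrite -e dvdp_gcdr.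
Qed.

(** The content is factored in [D], and the primitive part by induction on the degree: if it is
    reducible over the fraction field, it splits into two primitive factors of smaller degree. *)
Lemma factorial_poly (D : idomainType) :
  factorial_domain D -> factorial_domain {poly D}.
Proof.
move=> uD.
have uC (c : D) : c != 0 -> exists (u : {poly D}) (s : seq {poly D}),
    [/\ u \is a GRing.unit, forall y, y \in s -> prime_elt y &
        c%:P = u * \prod_(y <- s) y].
  move=> /uD[u [s [uU sP ->]]]; exists u%:P, [seq y%:P | y <- s]; split.
  - by rewrite rmorph_unit.
  - by move=> _ /mapP[y ys ->]; apply/prime_polyC/sP.
  - by rewrite polyCM big_map rmorph_prod.
have prim n (f : {poly D}) : (size f <= n)%N -> (1 < size f)%N -> primitive f ->
    exists s : seq {poly D}, (forall y, y \in s -> prime_elt y) /\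
      f = \prod_(y <- s) y.
  elim: n f => [|n IH] f fn f1 fP; first by move: (leq_trans f1 fn).
  have [fI|fI] := pselect (irreducible_poly f).
    exists [:: f]; split; last by rewrite big_seq1.
    by move=> y; rewrite inE => /eqP->; apply: primitive_prime.
  have f0 : f != 0 by rewrite -size_poly_gt0 ltnW.
  have [g [g1 gf ngf]] : exists g : {poly D}, [/\ size g != 1%N, g %| f & ~~ (g %= f)].
    apply: contra_notP fI => h; split=> // g g1 gf; apply/negP => /negP e.
    by apply: h; exists g.
  have g0 : g != 0 by apply: contraTneq gf => ->; rewrite dvd0p.
  have [d [k [d0 kP hk]]] := primitive_part uD g0.
  have sk : size k = size g by rewrite hk size_scale.
  have [[c w] /= c0 hw] := Pdiv.WeakIdomain.dvdpP _ _ gf.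
  (* The divisor [g] is only a pseudo-divisor; its primitive part [k] divides [f] genuinely, by
     Gauss. *)
  have [[w' hw'] _] : divides k f /\ divides c%:P (d *: w).
    by apply: gauss_primitive => //; rewrite hw hk -scalerAr scalerAl.
  have w0 : w' != 0 by apply: contraNneq f0 => e; rewrite hw' e mul0r.
  have k0 : k != 0 by rewrite -size_poly_gt0 sk size_poly_gt0.
  have k1 : (1 < size k)%N by rewrite ltn_neqAle eq_sym sk g1 size_poly_gt0.
  have sf : size f = (size w' + size k).-1 by rewrite hw' size_mul.
  have sw : (size g < size f)%N.
    by rewrite ltn_neqAle dvdp_leq // andbT (dvdp_size_eqp gf).
  have w1 : (1 < size w')%N.
    by rewrite sk in sf k1; lia.
  have [|||s1 [s1P e1]] := IH w' => //.
  - by rewrite sk in sf k1; lia.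
  - by move=> x xP hx; apply: (fP x xP); rewrite hw'; apply: divides_mulr.
  have [|||s2 [s2P e2]] := IH k => //.
  - by rewrite sk -ltnS (leq_trans sw).
  exists (s1 ++ s2); split; last by rewrite big_cat /= -e1 -e2.
  by move=> y; rewrite mem_cat => /orP[/s1P|/s2P].
move=> f f0; have [f1|f1] := leqP (size f) 1.
  by rewrite (size1_polyC f1); apply: uC; rewrite -polyC_eq0 -size1_polyC.
have [c [g [c0 gP hg]]] := primitive_part uD f0.
have [u [s [uU sP hc]]] := uC c c0.
have [||s' [s'P hg']] := prim (size g) g (leqnn _) => //.
  by move: f1; rewrite hg size_scale.
exists u, (s ++ s'); split=> //.
  by move=> y; rewrite mem_cat => /orP[/sP|/s'P].
by rewrite big_cat /= mulrA -hc -hg' mul_polyC.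
Qed.

Lemma factorial_iso (A B : idomainType) (f : {rmorphism A -> B})
    (g : {rmorphism B -> A}) :
  cancel f g -> cancel g f -> factorial_domain A -> factorial_domain B.
Proof.
move=> fK gK uA x x0.
have dv a b : divides (f a) b <-> divides a (g b).
  split=> [[c ->]|[c hc]]; first by exists (g c); rewrite rmorphM fK.
  by exists (f c); rewrite -rmorphM -hc gK.
have [|u [s [uU sP e]]] := uA (g x); first by rewrite -(rmorph0 g) (can_eq gK).
exists (f u), [seq f y | y <- s]; split; first exact: rmorph_unit.
  move=> _ /mapP[y /sP[y0 yU yP] ->]; split.
  - by rewrite -(rmorph0 f) (can_eq fK).
  - by apply: contraNN yU => /(rmorph_unit g); rewrite fK.
  by move=> a b; rewrite !dv rmorphM; apply: yP.
by rewrite big_map -rmorph_prod -rmorphM -e gK.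
Qed.

Local Notation mvar i := (mpolyX _ (mnm1 i)).

(** Most evaluation and substitution identities below are reduced by this to a check on constants
    and variables. *)
Lemma mpoly_rmorph_ext (n : nat) (R S : nzRingType)
    (f g : {rmorphism mpoly n R -> S}) :
  (forall c, f (mpolyC n c) = g (mpolyC n c)) ->
  (forall i, f (mvar i) = g (mvar i)) -> f =1 g.
Proof.
move=> fgC fgX p; rewrite (mpolyE p) !rmorph_sum; apply: eq_bigr => m _ /=.
rewrite -mul_mpolyC !rmorphM /= fgC; congr (_ * _).
rewrite mpolyXE_id !rmorph_prod; apply: eq_bigr => i _.
by rewrite !rmorphXn fgX.
Qed.

Lemma factorial_mpolyS (n : nat) (F : fieldType) :
  factorial_domain (mpoly n F) -> factorial_domain (mpoly n.+1 F).
Proof.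
move=> uF.
(* The isomorphism with [{poly (mpoly n F)}] sends the last variable to ['X]; [f] and its inverse
   [g] are built as substitutions. *)
have [f fC fX] : exists2 f : {rmorphism mpoly n.+1 F -> {poly (mpoly n F)}},
    forall c, f (mpolyC n.+1 c) = (mpolyC n c)%:P &
    forall i, f (mvar i) = oapp (fun j => (mvar j)%:P) 'X (unlift ord_max i).
  exists (mmap (polyC \o @mpolyC n F)
    (fun i => oapp (fun j => (mvar j)%:P) 'X (unlift ord_max i))) => *.
    by rewrite /= mmapC.
  by rewrite /= mmapX mmap1U.
have [w wC wX] : exists2 w : {rmorphism mpoly n F -> mpoly n.+1 F},
    forall c, w (mpolyC n c) = mpolyC n.+1 c &
    forall j, w (mvar j) = mvar (lift ord_max j).
  exists (mmap (@mpolyC n.+1 F) (fun j => mvar (lift ord_max j))) => *.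
    by rewrite /= mmapC.
  by rewrite /= mmapX mmap1U.
have [g gX gC] : exists2 g : {rmorphism {poly (mpoly n F)} -> mpoly n.+1 F},
    g 'X = mvar ord_max & forall c, g c%:P = w c.
  exists (horner_eval (mvar ord_max) \o map_poly w : {rmorphism _ -> _}).
    by rewrite /= map_polyX /horner_eval hornerX.
  by move=> c; rewrite /= map_polyC /horner_eval hornerC.
have fw c : f (w c) = c%:P.
  apply: (@mpoly_rmorph_ext n F _ (f \o w) (@polyC _)) => [a|j] /=.
    by rewrite wC fC.
  by rewrite wX fX liftK.
have fK : cancel f g.
  apply: (@mpoly_rmorph_ext n.+1 F _ (g \o f) idfun) => [c|i] /=.
    by rewrite fC gC wC.
  by rewrite fX; case: unliftP => [j|] -> /=; rewrite ?gC ?gX ?wX.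
have gK : cancel g f.
  elim/poly_ind => [|p c IH]; first by rewrite !rmorph0.
  by rewrite !(rmorphD, rmorphM) /= IH gC gX fX unlift_none /= fw.
exact: (factorial_iso gK fK (factorial_poly uF)).
Qed.

Lemma factorial_mpoly (n : nat) (F : fieldType) : factorial_domain (mpoly n F).
Proof.
elim: n => [|n IH]; last exact: factorial_mpolyS.
move=> p p0; exists p, [::]; rewrite big_nil mulr1; split=> //.
have ep : p = mpolyC 0 (mcoeff mnm0 p).
  apply/mpolyP => m; rewrite mcoeffC; have -> : m = mnm0 by apply/mnmP => -[].
  by rewrite eqxx mulr1.
apply/unitrPr; exists (mpolyC 0 (mcoeff mnm0 p)^-1).
rewrite {1}ep -mpolyCM mulfV ?mpolyC1 //.
by apply: contraNneq p0 => e; rewrite ep e mpolyC0.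
Qed.

(** The prime factors of [p] are cancelled one by one; by coprimality none of them divides [q], so
    each divides [v]. *)
Lemma coprime_divides (D : idomainType) (p q v : D) :
  factorial_domain D -> p != 0 ->
  (forall g a b, p = g * a -> q = g * b -> g \is a GRing.unit) ->
  divides p (q * v) -> divides p v.
Proof.
move=> uD p0; have [u [s [uU sP ->]]] := uD p p0.
elim: s sP v => [|x s IH] sP v co.
  by rewrite big_nil mulr1 => _; exists (v / u); rewrite divrK.
have xP : prime_elt x by apply: sP; rewrite inE eqxx.
have [x0 xU xpr] := xP.
rewrite big_cons mulrCA => -[c hc].
case: (xpr q v); first by exists (c * (u * \prod_(y <- s) y)); rewrite hc; ring.
  move=> [b hb]; case/negP: xU.
  by apply: (co x (u * \prod_(y <- s) y) b); rewrite ?big_cons ?hb; ring.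
move=> [v' hv]; have [|||d hd] := IH _ v'.
- by move=> y ys; apply: sP; rewrite inE ys orbT.
- move=> g a b e1 e2; apply: (co g (a * x) b) => //.
  by rewrite big_cons mulrCA e1; ring.
- by exists c; apply: (mulIf x0); rewrite -!mulrA -hv hc; ring.
by exists d; rewrite hv hd; ring.
Qed.

(** * Restriction of a polynomial to a line *)

(** The restriction of a polynomial to the line [t a + x], with coefficients transported to [K]. The
    ring [K] will be the reals, the complex numbers, or the polynomial ring itself, where [x] is the
    generic point. *)
Definition affine_line (n : nat) (R : nzRingType) (K : comNzRingType)
    (f : R -> K) (a x : 'I_n -> K) : mpoly n R -> {poly K} :=
  mmap (polyC \o f) (fun i => a i *: 'X + (x i)%:P).

HB.instance Definition _ (n : nat) (R : nzRingType) (K : comNzRingType)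
    (f : {rmorphism R -> K}) (a x : 'I_n -> K) :=
  GRing.RMorphism.copy (affine_line f a x)
    (mmap (polyC \o f) (fun i => a i *: 'X + (x i)%:P)).

Section AffineLine.
Variables (n : nat) (R : nzRingType) (K : comNzRingType).
Variables (f : {rmorphism R -> K}) (a x : 'I_n -> K).

Lemma affine_lineC c : affine_line f a x (mpolyC n c) = (f c)%:P.
Proof. by rewrite /affine_line mmapC. Qed.

Lemma affine_lineX i : affine_line f a x (mvar i) = a i *: 'X + (x i)%:P.
Proof. by rewrite /affine_line mmapX mmap1U. Qed.

Lemma horner_affine_line p t :
  (affine_line f a x p).[t] = mmap f (fun i => a i * t + x i) p.
Proof.
apply: (mpoly_rmorph_ext (f := horner_eval t \o affine_line f a x)) => [c|i] /=.
  by rewrite affine_lineC mmapC /horner_eval hornerC.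
by rewrite affine_lineX mmapX mmap1U /horner_eval !hornerE.
Qed.

(** The chain rule. It holds for constants and variables and is stable under sums and products. *)
Lemma deriv_affine_line p :
  (affine_line f a x p)^`() = \sum_i a i *: affine_line f a x (mderiv i p).
Proof.
pose P p := (affine_line f a x p)^`() = \sum_i a i *: affine_line f a x (mderiv i p).
have PM p1 p2 : P p1 -> P p2 -> P (p1 * p2).
  rewrite /P !rmorphM derivM => -> ->; rewrite mulr_suml mulr_sumr -big_split.
  apply: eq_bigr => i _; rewrite mderivM rmorphD !rmorphM /=.
  by rewrite scalerDr -scalerAl -scalerAr.
have PD p1 p2 : P p1 -> P p2 -> P (p1 + p2).
  rewrite /P !rmorphD derivD => -> ->; rewrite -big_split.
  by apply: eq_bigr => i _; rewrite mderivD rmorphD scalerDr.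
have PC c : P (mpolyC n c).
  by rewrite /P affine_lineC derivC big1 // => i _; rewrite mderivC rmorph0 scaler0.
have PX i : P (mvar i).
  rewrite /P affine_lineX derivD derivC addr0 derivZ derivX.
  rewrite (bigD1 i) //= big1 ?addr0 => [|j ji].
    have e0 : mnm_sub (mnm1 i) (mnm1 i) = mnm0.
      by apply/mnmP => j; rewrite mnmBE mnm0E subnn.
    by rewrite mderivX mnm1E eqxx scale1r e0 mpolyX0 rmorph1 alg_polyC.
  by rewrite mderivX mnm1E eq_sym (negPf ji) scale0r rmorph0 scaler0.
rewrite -/(P p) (mpolyE p); elim/big_rec: _ => [|m q _ Pq].
  by rewrite -(mpolyC0 n); apply: PC.
apply: PD Pq; rewrite -mul_mpolyC; apply: (PM) => //.
rewrite mpolyXE_id; elim/big_rec: _ => [|i r _ Pr]; first by rewrite -mpolyC1.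
apply: (PM _ _ _ Pr); elim: (m i) => [|k IH]; first by rewrite expr0 -mpolyC1.
by rewrite exprS; apply: (PM).
Qed.

End AffineLine.

Section AffineLineHomog.
Variables (n : nat) (R : nzRingType) (K : comNzRingType).
Variables (f : {rmorphism R -> K}) (a x : 'I_n -> K).

(** A formal degree with its top coefficient. Allowing [c = 0] makes the notion multiplicative over
    any commutative ring. *)
Let deg_coef (k : nat) (c : K) (P : {poly K}) := (size P <= k.+1)%N /\ P`_k = c.

Let deg_coefM j k c d P Q :
  deg_coef j c P -> deg_coef k d Q -> deg_coef (j + k) (c * d) (P * Q).
Proof.
move=> [sP <-] [sQ <-]; split.
  by apply: leq_trans (size_polyMleq _ _) _; lia.
rewrite coefM (bigD1 (inord j)) //= inordK ?ltnS ?leq_addr // addKn.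
rewrite big1 ?addr0 // => i; rewrite -val_eqE /= inordK ?ltnS ?leq_addr // => ij.
have [ltij|leji] := ltnP i j.
  by rewrite [Q`__]nth_default ?mulr0 // (leq_trans sQ) //; lia.
by rewrite nth_default ?mul0r // (leq_trans sP) //; lia.
Qed.

Let deg_coef_mmap1 m :
  deg_coef (mdeg m) (mmap1 a m) (mmap1 (fun i => a i *: 'X + (x i)%:P) m).
Proof.
rewrite /mmap1 mdegE; elim/big_rec3: _ => [|i P c k _ IH].
  by split; rewrite ?size_poly1 // coef1.
apply: deg_coefM IH; elim: (m i) => [|l IHl].
  by split; rewrite !expr0 ?size_poly1 // coef1.
rewrite !exprS -add1n; apply: deg_coefM IHl; split.
  rewrite -mul_polyC; apply: leq_trans (size_polyD _ _) _.
  rewrite geq_max (leq_trans (size_polyC_leq1 _)) // andbT.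
  by rewrite mul_polyC (leq_trans (size_scale_leq _ _)) // size_polyX.
by rewrite coefD coefZ coefX coefC /= mulr1 addr0.
Qed.

Variables (d : nat) (p : mpoly n R).
Hypothesis hp : p \is ishomog1 d mdeg.

Let deg_coef_affine_line : deg_coef d (mmap f a p) (affine_line f a x p).
Proof.
rewrite /affine_line /mmap big_seq [X in deg_coef _ _ X]big_seq.
elim/big_rec2: _ => [|m P c hm [sP hP]]; first by split; rewrite ?size_poly0 ?coef0.
have [s1 c1] := deg_coef_mmap1 m.
have e : mdeg m = d := dhomog_mf hp hm; rewrite e in s1 c1.
split; last by rewrite coefD /= mul_polyC coefZ c1 hP.
apply: leq_trans (size_polyD _ _) _; rewrite geq_max sP andbT mul_polyC.
by rewrite (leq_trans (size_scale_leq _ _)).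
Qed.

Lemma size_affine_line_homog : (size (affine_line f a x p) <= d.+1)%N.
Proof. by case: deg_coef_affine_line. Qed.

Lemma coef_affine_line_homog : (affine_line f a x p)`_d = mmap f a p.
Proof. by case: deg_coef_affine_line. Qed.

Lemma mmap_homog t : mmap f (fun i => t * a i) p = t ^+ d * mmap f a p.
Proof.
rewrite /mmap big_distrr /= [LHS]big_seq [RHS]big_seq; apply: eq_bigr => m hm.
rewrite mulrCA; congr (_ * _).
have <- : mdeg m = d := dhomog_mf hp hm.
rewrite /mmap1 mdegE.
rewrite -prodrXr -big_split /=; apply: eq_bigr => i _; by rewrite exprMn.
Qed.

End AffineLineHomog.

(** Up to constants, the witness is the cofactor of the greatest common divisor in [P]; it is
    shorter than [P] because that divisor is not constant. *)
Lemma ncoprimep_syzygy (D : idomainType) (P Q : {poly D}) :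
  P != 0 -> ~~ coprimep P Q ->
  exists a : {poly D}, [/\ a != 0, (size a < size P)%N & divides P (Q * a)].
Proof.
move=> P0; rewrite /coprimep => gN1.
have g0 : gcdp P Q != 0 by rewrite gcdp_eq0 negb_and P0.
have [[c1 a] /= c10 ha] := Pdiv.WeakIdomain.dvdpP _ _ (dvdp_gcdl P Q).
have [[c2 b] /= c20 hb] := Pdiv.WeakIdomain.dvdpP _ _ (dvdp_gcdr P Q).
have a0 : a != 0.
  apply/eqP => ea; move: P0.
  by rewrite -size_poly_gt0 -(size_scale P c10) ha ea mul0r size_poly0.
exists (c2 *: a); split; first by rewrite -size_poly_gt0 size_scale // size_poly_gt0.
  have := congr1 (fun P : {poly D} => size P) ha.
  rewrite /= size_mul // !size_scale // => ->.
  by move: g0 a0; rewrite -!size_poly_gt0; lia.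
exists (c1 *: b); move: ha hb; rewrite -!mul_polyC => ha hb.
by rewrite mulrCA mulrA hb mulrAC -!mulrA (mulrCA c1%:P) ha; ring.
Qed.

(** The morphism [S] turns [P] and [Q] into the constants [p] and [q], where divisibility is tested
    coefficient by coefficient in [D]; [T] brings the quotient back. *)
Lemma coprime_divides_shift (D : idomainType) (p q : D) (P Q a : {poly D})
    (S T : {rmorphism {poly D} -> {poly D}}) :
  factorial_domain D -> p != 0 ->
  (forall g a b, p = g * a -> q = g * b -> g \is a GRing.unit) ->
  cancel S T -> S P = p%:P -> S Q = q%:P ->
  divides P (Q * a) -> divides P a.
Proof.
move=> uD p0 co TS SP SQ [w hw].
have [v hv] : divides p%:P (S a).
  apply/divides_polyC => k; apply: (coprime_divides uD p0 co).
  have := congr1 (fun R => (S R)`_k) hw; rewrite /= !rmorphM SP SQ coefCM coefMC.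
  by move=> ->; exists (S w)`_k.
by exists (T v); rewrite -[LHS]TS hv rmorphM -SP TS.
Qed.

Lemma bezout_rmorph_eq0 (A B : comNzRingType) (f : {rmorphism A -> B}) (u v a b c : A) :
  u * a + v * b = c -> f a = 0 -> f b = 0 -> f c = 0.
Proof. by move=> <- fa fb; rewrite rmorphD !rmorphM fa fb !mulr0 addr0. Qed.

(** * Common roots on a generic line *)

Section GenericLine.
Variables (n : nat) (F : fieldType).
Local Notation D := (mpoly n F).
Local Notation line e :=
  (affine_line (@mpolyC n F) (fun i => mpolyC n (e i)) (fun i => mvar i)).

(** The substitution of [x + 'X e] for the variables [x], fixing ['X]. The shift by [- e] undoes the
    restriction to the generic line of direction [e]. *)
Let shift (e : 'I_n -> F) : exists S : {rmorphism {poly D} -> {poly D}},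
  S 'X = 'X /\ forall c, S c%:P = line e c.
Proof.
exists (horner_eval 'X \o map_poly (line e) : {rmorphism _ -> _}); split.
  by rewrite /= map_polyX /horner_eval hornerX.
by move=> c; rewrite /= map_polyC /horner_eval hornerC.
Qed.

Let shiftK (e e' : 'I_n -> F) (S : {rmorphism {poly D} -> {poly D}}) :
  (forall i, e' i = - e i) -> S 'X = 'X -> (forall c, S c%:P = line e' c) ->
  forall c, S (line e c) = c%:P.
Proof.
move=> ee SX SC; apply: (mpoly_rmorph_ext (f := S \o line e) (g := @polyC D)) => [c|i] /=.
  by rewrite affine_lineC SC affine_lineC.
rewrite affine_lineX -mul_polyC rmorphD rmorphM /= !SC SX affine_lineC affine_lineX ee.
rewrite rmorphN -!mul_polyC polyCN; ring.
Qed.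

(** Otherwise there is a nonzero [a], shorter than [line e p], with [line e p] dividing
    [line e q * a]. Shifting by [- e] makes both restrictions constant, so coprimality forces
    [line e p] to divide [a], against the sizes. *)
Lemma generic_line_bezout (d : nat) (p q : D) (e : 'I_n -> F) :
  (forall g a b, p = g * a -> q = g * b -> g \is a GRing.unit) ->
  p \is ishomog1 d mdeg -> meval e p != 0 ->
  exists (u v : {poly D}) (c : D), c != 0 /\ u * line e p + v * line e q = c%:P.
Proof.
move=> co hp pe.
have [S [SX SC]] := shift (fun i => - e i).
have [T [TX TC]] := shift e.
have Sline : forall c, S (line e c) = c%:P by apply: shiftK SX SC.
have Tline : forall c, T (line (fun i => - e i) c) = c%:P.
  by apply: shiftK TX TC => i; rewrite opprK.
have TS : cancel S T.
  elim/poly_ind => [|P c IH]; first by rewrite !rmorph0.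
  by rewrite !(rmorphD, rmorphM) /= IH SX TX SC Tline.
have p0 : p != 0 by apply: contraNneq pe => ->; rewrite rmorph0.
have coef : (line e p)`_d = mpolyC n (meval e p).
  rewrite (coef_affine_line_homog _ _ _ hp).
  apply: (mpoly_rmorph_ext (f := mmap (@mpolyC n F) (fun i => mpolyC n (e i)))
    (g := @mpolyC n F \o meval e)) => [c|i] /=; first by rewrite mmapC mevalC.
  by rewrite mmapX mmap1U mevalXU.
have P0 : line e p != 0.
  apply: contraNneq pe => h; move: coef; rewrite h coef0 => /esym/eqP.
  by rewrite mpolyC_eq0.
suff /Bezout_coprimepP[[u v] /= huv] : coprimep (line e p) (line e q).
  have /eqp_size := huv; rewrite size_poly1 => s1.
  exists u, v, (u * line e p + v * line e q)`_0; split; last first.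
    by rewrite -size1_polyC // s1.
  by rewrite -polyC_eq0 -size1_polyC -?size_poly_gt0 s1.
apply/negPn/negP => /(ncoprimep_syzygy P0)[a [a0 sa hdiv]].
have [W hW] := coprime_divides_shift (@factorial_mpoly n F) p0 co TS
  (Sline p) (Sline q) hdiv.
have W0 : W != 0 by apply: contraNneq a0 => W0; rewrite hW W0 mul0r.
move: sa; rewrite hW size_mul //; move: W0; rewrite -size_poly_gt0.
by case: (size W) => // k _; rewrite addSn /= ltnNge leq_addl.
Qed.

Lemma line_evaluation (K : comNzRingType) (f : {rmorphism F -> K})
    (e x : 'I_n -> F) (z : K) :
  exists ev : {rmorphism {poly D} -> K},
    (forall p, ev (line e p) = mmap f (fun i => f (e i) * z + f (x i)) p) /\
    forall c, ev c%:P = f (meval x c).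
Proof.
have [ev evX evC] : exists2 ev : {rmorphism {poly D} -> K},
    ev 'X = z & forall c, ev c%:P = f (meval x c).
  exists (horner_eval z \o map_poly (f \o meval x) : {rmorphism _ -> _}).
    by rewrite /= map_polyX /horner_eval hornerX.
  by move=> c; rewrite /= map_polyC /horner_eval hornerC.
exists ev; split=> //.
apply: (mpoly_rmorph_ext (f := ev \o line e)) => [c|i] /=.
  by rewrite affine_lineC evC mevalC mmapC.
rewrite affine_lineX mmapX mmap1U -mul_polyC rmorphD rmorphM !evC evX.
by rewrite mevalC mevalXU.
Qed.

(** The Bezout constant [c] acts as a resultant in the base point [x]. Since [K] is arbitrary, the
    parameter [z] may be complex while [x] stays real. *)
Lemma generic_line_no_common_root (d : nat) (p q : D) (e : 'I_n -> F) :
  (forall g a b, p = g * a -> q = g * b -> g \is a GRing.unit) ->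
  p \is ishomog1 d mdeg -> meval e p != 0 ->
  exists c : D, c != 0 /\
    forall (K : comNzRingType) (f : {rmorphism F -> K}) (x : 'I_n -> F) (z : K),
      mmap f (fun i => f (e i) * z + f (x i)) p = 0 ->
      mmap f (fun i => f (e i) * z + f (x i)) q = 0 -> f (meval x c) = 0.
Proof.
move=> co hp pe; have [u [v [c [c0 bez]]]] := generic_line_bezout co hp pe.
exists c; split=> // K f x z; have [ev [evL evC]] := line_evaluation f e x z.
move=> p0 q0; have evp : ev (line e p) = 0 by rewrite evL.
have evq : ev (line e q) = 0 by rewrite evL.
by rewrite -evC; apply: bezout_rmorph_eq0 bez evp evq.
Qed.

End GenericLine.

(** * Formal power series *)

(** The record keeps the Cauchy product apart from the pointwise product of functions. *)
Record fps (K : Type) := Fps { fcoef : nat -> K }.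

Section PowerSeries.
Variable K : comNzRingType.
Local Notation fps := (fps K).
Implicit Types a b c : fps.

HB.instance Definition _ := gen_eqMixin fps.
HB.instance Definition _ := gen_choiceMixin fps.

Definition fps_trunc n a : {poly K} := \poly_(i < n) fcoef a i.
Definition fps_of_poly (P : {poly K}) : fps := Fps (fun k => P`_k).

Lemma fpsP a b : (forall k, fcoef a k = fcoef b k) -> a = b.
Proof. by case: a b => [f] [g] /= fg; congr Fps; apply/funext. Qed.

Let add a b := Fps (fun k => fcoef a k + fcoef b k).
Let opp a := Fps (fun k => - fcoef a k).
Let mul a b := Fps (fun k => (fps_trunc k.+1 a * fps_trunc k.+1 b)`_k).

(** The ring laws for series come from those for polynomials, because a coefficient of a product
    only sees coefficients of at most the same index. *)
Let coefM_low (P P' Q Q' : {poly K}) k :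
  (forall i, (i <= k)%N -> P`_i = P'`_i) ->
  (forall i, (i <= k)%N -> Q`_i = Q'`_i) -> (P * Q)`_k = (P' * Q')`_k.
Proof.
move=> hP hQ; rewrite !coefM; apply: eq_bigr => i _.
by rewrite hP ?hQ ?leq_subr // -ltnS.
Qed.

Let coef_trunc n a i : (i < n)%N -> (fps_trunc n a)`_i = fcoef a i.
Proof. by move=> h; rewrite coef_poly h. Qed.

Let mulE n a b k : (k < n)%N ->
  fcoef (mul a b) k = (fps_trunc n a * fps_trunc n b)`_k.
Proof.
by move=> kn; apply: coefM_low => i ik; rewrite !coef_trunc // (leq_ltn_trans ik).
Qed.

Let addA : associative add.
Proof. by move=> a b c; apply: fpsP => k /=; rewrite addrA. Qed.
Let addC : commutative add.
Proof. by move=> a b; apply: fpsP => k /=; rewrite addrC. Qed.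
Let add0 : left_id (fps_of_poly 0) add.
Proof. by move=> a; apply: fpsP => k /=; rewrite coef0 add0r. Qed.
Let addN : left_inverse (fps_of_poly 0) opp add.
Proof. by move=> a; apply: fpsP => k /=; rewrite addNr coef0. Qed.

HB.instance Definition _ := GRing.isZmodule.Build fps addA addC add0 addN.

Let mulA : associative mul.
Proof.
move=> a b c; apply: fpsP => k; rewrite !(@mulE k.+1) //.
rewrite (@coefM_low _ (fps_trunc k.+1 a) _ (fps_trunc k.+1 b * fps_trunc k.+1 c)) //.
  rewrite mulrA; apply: coefM_low => // i ik.
  by rewrite coef_trunc // (@mulE k.+1).
by move=> i ik; rewrite coef_trunc // (@mulE k.+1).
Qed.
Let mulC : commutative mul.
Proof. by move=> a b; apply: fpsP => k /=; rewrite mulrC. Qed.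
Let mul1 : left_id (fps_of_poly 1) mul.
Proof.
move=> a; apply: fpsP => k /=.
rewrite -[RHS](@coef_trunc k.+1) // -[in RHS](mul1r (fps_trunc _ _)).
by apply: coefM_low => // i ik; rewrite coef_trunc.
Qed.
Let mulDl : left_distributive mul +%R.
Proof.
move=> a b c; apply: fpsP => k /=; rewrite -coefD -mulrDl.
by apply: coefM_low => // i ik; rewrite coefD !coef_trunc.
Qed.
Let one_neq0 : fps_of_poly 1 != 0.
Proof.
apply/eqP => /(congr1 (fun a => fcoef a 0)) /=; rewrite coef1 coef0 => /eqP.
by rewrite oner_eq0.
Qed.

HB.instance Definition _ :=
  GRing.Zmodule_isComNzRing.Build fps mulA mulC mul1 mulDl one_neq0.

Lemma fcoefD a b k : fcoef (a + b) k = fcoef a k + fcoef b k.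
Proof. by []. Qed.
Lemma fcoefN a k : fcoef (- a) k = - fcoef a k.
Proof. by []. Qed.
Lemma fcoefB a b k : fcoef (a - b) k = fcoef a k - fcoef b k.
Proof. by []. Qed.

Lemma fcoef_poly P k : fcoef (fps_of_poly P) k = P`_k.
Proof. by []. Qed.
Lemma fcoef0 k : fcoef (0 : fps) k = 0.
Proof. exact: coef0. Qed.

Lemma fps_of_poly_is_additive : zmod_morphism fps_of_poly.
Proof. by move=> P Q; apply: fpsP => k /=; rewrite coefB. Qed.

Lemma fps_of_poly_is_multiplicative : monoid_morphism fps_of_poly.
Proof.
split=> // P Q; apply: fpsP => k /=.
by apply: coefM_low => i ik; rewrite coef_trunc.
Qed.

HB.instance Definition _ :=
  GRing.isZmodMorphism.Build {poly K} fps fps_of_poly fps_of_poly_is_additive.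
HB.instance Definition _ :=
  GRing.isMonoidMorphism.Build {poly K} fps fps_of_poly fps_of_poly_is_multiplicative.

Definition fps_deriv a := Fps (fun k => fcoef a k.+1 *+ k.+1).

Lemma fcoef_deriv a k : fcoef (fps_deriv a) k = fcoef a k.+1 *+ k.+1.
Proof. by []. Qed.

Lemma fps_derivM a b : fps_deriv (a * b) = fps_deriv a * b + a * fps_deriv b.
Proof.
apply: fpsP => k; rewrite fcoefD /=.
rewrite -coef_deriv derivM coefD; congr (_ + _).
  by apply: coefM_low => i ik; rewrite ?coef_deriv !coef_trunc // ltnS leqW.
by apply: coefM_low => i ik; rewrite ?coef_deriv !coef_trunc // ltnS leqW.
Qed.

Lemma fps_deriv_poly P : fps_deriv (fps_of_poly P) = fps_of_poly P^`().
Proof. by apply: fpsP => k /=; rewrite coef_deriv. Qed.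

Lemma fcoef_polyC_mul (z : K) a k :
  fcoef (fps_of_poly z%:P * a) k = z * fcoef a k.
Proof.
have -> : fcoef (fps_of_poly z%:P * a) k = (z%:P * fps_trunc k.+1 a)`_k.
  by apply: coefM_low => // i ik; rewrite coef_trunc.
by rewrite coefCM coef_trunc.
Qed.

Lemma fcoef_polyX_mul a k :
  fcoef (fps_of_poly 'X * a) k = if k is j.+1 then fcoef a j else 0.
Proof.
have -> : fcoef (fps_of_poly 'X * a) k = ('X * fps_trunc k.+1 a)`_k.
  by apply: coefM_low => // i ik; rewrite coef_trunc.
by rewrite coefXM; case: k => //= k; rewrite coef_trunc.
Qed.

Lemma fcoef_XsubC_mul (z : K) a k : fcoef (fps_of_poly ('X - z%:P) * a) k =
  (if k is j.+1 then fcoef a j else 0) - z * fcoef a k.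
Proof. by rewrite rmorphB mulrBl fcoefB fcoef_polyC_mul fcoef_polyX_mul. Qed.

Lemma fcoef_1subCX_mul (z : K) a k : fcoef (fps_of_poly (1 - z%:P * 'X) * a) k =
  fcoef a k - z * (if k is j.+1 then fcoef a j else 0).
Proof.
rewrite rmorphB rmorph1 rmorphM mulrBl mul1r fcoefB -mulrA fcoef_polyC_mul.
by rewrite fcoef_polyX_mul.
Qed.

Lemma fcoefM0 a b : fcoef (a * b) 0 = fcoef a 0 * fcoef b 0.
Proof. by rewrite /= coefM big_ord_recl big_ord0 addr0 !coef_trunc. Qed.

End PowerSeries.

Arguments fcoef {K} _ _ : simpl never.

(** * Regular singular points with negative exponent *)

Section Decay.
Variable R : realType.
Local Notation C := R[i].
Implicit Types (b g : fps C) (z w : C).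

Definition sqnorm z := complex.Re z ^+ 2 + complex.Im z ^+ 2.

Lemma sqnorm_ge0 z : 0 <= sqnorm z.
Proof. by rewrite addr_ge0 ?sqr_ge0. Qed.

Lemma sqnormM z w : sqnorm (z * w) = sqnorm z * sqnorm w.
Proof. by case: z w => a b [c d]; rewrite /sqnorm /=; ring. Qed.

Lemma sqnormD_le z w : sqnorm (z + w) <= 2 * sqnorm z + 2 * sqnorm w.
Proof.
case: z w => a b [c d]; rewrite /sqnorm /=; rewrite -subr_ge0.
have -> : 2 * (a ^+ 2 + b ^+ 2) + 2 * (c ^+ 2 + d ^+ 2) -
  ((a + c) ^+ 2 + (b + d) ^+ 2) = (a - c) ^+ 2 + (b - d) ^+ 2 by ring.
by rewrite addr_ge0 ?sqr_ge0.
Qed.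

Lemma sqnormMn z n : sqnorm (z *+ n) = sqnorm z * n%:R ^+ 2.
Proof.
rewrite -[z *+ n]mulr_natr sqnormM; congr (_ * _).
by rewrite -[n%:R](rmorph_nat (real_complex R)) /sqnorm /= expr0n addr0.
Qed.

Lemma sqnorm_normc z : sqnorm z = Normc.normc z ^+ 2.
Proof. by case: z => a b; rewrite /sqnorm /= sqr_sqrtr ?addr_ge0 ?sqr_ge0. Qed.

(** Decay faster than every power of the index. It follows from a radius of convergence above 1,
    implies square summability, and is stable under differentiation and multiplication by
    polynomials. *)
Definition fps_decay b :=
  forall m, exists K : R, forall k, sqnorm (fcoef b k) * k.+1%:R ^+ m <= K.

Lemma fps_decayD b g : fps_decay b -> fps_decay g -> fps_decay (b + g).
Proof.
move=> hb hg m; have [K1 h1] := hb m; have [K2 h2] := hg m.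
exists (2 * K1 + 2 * K2) => k; rewrite fcoefD.
have p0 : 0 <= k.+1%:R ^+ m :> R by rewrite exprn_ge0.
apply: le_trans (ler_wpM2r p0 (sqnormD_le _ _)) _.
by rewrite mulrDl -!mulrA lerD // ler_pM2l.
Qed.

Lemma fps_decayN b : fps_decay b -> fps_decay (- b).
Proof.
move=> hb m; have [K h] := hb m; exists K => k; apply: le_trans (h k).
by rewrite fcoefN -mulN1r sqnormM {1}/sqnorm /= sqrrN oppr0 expr0n addr0 expr1n mul1r.
Qed.

Lemma fps_decay_scale z b : fps_decay b -> fps_decay (fps_of_poly z%:P * b).
Proof.
move=> hb m; have [K h] := hb m; exists (sqnorm z * K) => k.
by rewrite fcoef_polyC_mul sqnormM -mulrA ler_wpM2l // sqnorm_ge0.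
Qed.

Lemma fps_decay_shift b : fps_decay b -> fps_decay (fps_of_poly 'X * b).
Proof.
move=> hb m; have [K h] := hb m; exists (2 ^+ m * K) => -[|k].
  rewrite fcoef_polyX_mul /sqnorm /= expr0n addr0 mul0r mulr_ge0 ?exprn_ge0 //.
  by apply: le_trans (h 0); rewrite expr1n mulr1 sqnorm_ge0.
rewrite fcoef_polyX_mul.
apply: le_trans (_ : 2 ^+ m * (sqnorm (fcoef b k) * k.+1%:R ^+ m) <= _).
  rewrite mulrCA ler_wpM2l ?sqnorm_ge0 // -exprMn lerXn2r ?nnegrE ?mulr_ge0 //.
  by rewrite -natrM ler_nat; lia.
by rewrite ler_wpM2l ?exprn_ge0.
Qed.

Lemma fps_decay_poly P b : fps_decay b -> fps_decay (fps_of_poly P * b).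
Proof.
move=> hb; elim/poly_ind: P => [|P c IH].
  by rewrite -polyC0; apply: fps_decay_scale.
rewrite rmorphD rmorphM mulrDl -mulrA mulrCA; apply: fps_decayD.
  exact: fps_decay_shift.
exact: fps_decay_scale.
Qed.

Lemma fps_decay_deriv b : fps_decay b -> fps_decay (fps_deriv b).
Proof.
move=> hb m; have [K h] := hb m.+2; exists K => k.
apply: le_trans (h k.+1); rewrite fcoef_deriv sqnormMn -mulrA ler_wpM2l ?sqnorm_ge0 //.
rewrite -exprD add2n lerXn2r ?nnegrE // ler_nat //.
Qed.

(** With [rho = s ^+ 2], one factor [s ^+ k] absorbs one factor [k.+1]: a geometric sum bounds
    [s ^+ k * k.+1%:R] by [(1 - s)^-1]. The other factor is left to the induction. *)
Lemma bounded_exp_poly m (rho : R) : 0 <= rho < 1 ->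
  exists K : R, forall k, rho ^+ k * k.+1%:R ^+ m <= K.
Proof.
elim: m rho => [|m IH] rho /andP[r0 r1].
  by exists 1 => k; rewrite mulr1 exprn_ile1 // ltW.
pose s := Num.sqrt rho.
have s0 : 0 <= s by rewrite sqrtr_ge0.
have s1 : s < 1 by rewrite -sqrtr1 ltr_sqrt.
have ss : s ^+ 2 = rho by rewrite sqr_sqrtr.
have [|K h] := IH s; first by rewrite s0.
have K0 : 0 <= K by apply: le_trans (h 0); rewrite expr1n mulr1.
exists (K * (1 - s)^-1) => k.
have -> : rho ^+ k * k.+1%:R ^+ m.+1 = (s ^+ k * k.+1%:R ^+ m) * (s ^+ k * k.+1%:R).
  by rewrite -ss -exprM mulSn mul1n exprD exprS; ring.
apply: ler_pM => //; first by rewrite mulr_ge0 ?exprn_ge0.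
  by rewrite mulr_ge0 ?exprn_ge0.
rewrite -[leRHS]mul1r ler_pdivlMr ?subr_gt0 //.
suff : s ^+ k * k.+1%:R * (1 - s) <= 1 - s ^+ k.+1.
  by move/le_trans; apply; rewrite gerBl exprn_ge0.
elim: k => [|k IHk]; first by rewrite expr0 expr1 !mul1r.
rewrite !exprS [_.+2%:R]mulrSr; rewrite exprS in IHk.
have : 0 <= s ^+ k by rewrite exprn_ge0.
have : s ^+ k <= 1 by rewrite exprn_ile1 // ltW.
set t := s ^+ k in IHk *; set q := k.+1%:R in IHk * => t1 t0.
have : s * (t * q * (1 - s)) <= s * (1 - s * t) by rewrite ler_wpM2l.
have : s * t * (1 - s) <= 1 - s.
  by rewrite ler_piMl ?subr_ge0 ?mulr_ile1 // ltW.
lra.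
Qed.

Lemma fps_decay_geom b (K rho : R) : 0 <= rho < 1 ->
  (forall k, sqnorm (fcoef b k) <= K * rho ^+ k) -> fps_decay b.
Proof.
move=> hr hb m; have [M hM] := bounded_exp_poly m hr; exists (K * M) => k.
have K0 : 0 <= K by have := hb 0; rewrite expr0 mulr1; apply: le_trans; rewrite sqnorm_ge0.
apply: le_trans (ler_wpM2r _ (hb k)) _; first by rewrite exprn_ge0.
by rewrite -mulrA ler_wpM2l.
Qed.

End Decay.

(** * Algebra of the equation [L (G b' - W b) = - l G b] *)

Section OdeAlgebra.
Variable A : comNzRingType.
Implicit Types L G W B b chi : A.

(** With [g] the value of [G] at the singular point, [G = g + G1 L] allows the equation to be solved
    for [b], exhibiting a factor [L]. *)
Lemma ode_divide L G G1 g k l chi b : k * l * g = -1 ->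
  L * chi = - (l * (G * b)) -> G1 * L = G - g ->
  b = L * (k * (chi + l * (G1 * b))).
Proof.
move=> klg hchi hG.
have -> : L * (k * (chi + l * (G1 * b))) = k * (L * chi) + k * l * (G1 * L) * b by ring.
rewrite hchi hG; transitivity (- (k * l * g) * b); last by ring.
by rewrite klg opprK mul1r.
Qed.

(** Removing a factor [L] from the solution raises [l] by one. *)
Lemma ode_shift L dL G W l l1 b db : dL = 1 -> l1 = l + 1 ->
  L * (G * (dL * b + L * db) - W * (L * b)) = - (l * (G * (L * b))) ->
  L * (L * (G * db - W * b) - - (l1 * (G * b))) = 0.
Proof.
move=> -> -> /eqP; rewrite -subr_eq0 opprK => /eqP h; rewrite -[RHS]h; ring.
Qed.

(** Multiplying the solution by [B] changes [G] and [W] but leaves [l] alone. *)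
Lemma ode_twist L G W l B dB b db : L * (G * db - W * b) = - (l * (G * b)) ->
  L * (G * B * (dB * b + B * db) - (G * dB + W * B) * (B * b)) =
    - (l * (G * B * (B * b))).
Proof.
move=> h; transitivity (B * B * (L * (G * db - W * b))); first by ring.
by rewrite h; ring.
Qed.

End OdeAlgebra.

(** * Division by Blaschke factors *)

Section Blaschke.
Variable R : realType.
Local Notation C := R[i].
Local Notation Cr := (real_complex R).
Local Notation ser := (@fps_of_poly C).
Implicit Types (b g : fps C).

(** A finite form of the equality of [|1 - u z|] and [|z - u|] on the unit circle: truncation leaves
    only the boundary term in the last coefficient. *)
Lemma sqnorm_blaschke (u : R) g n :
  \sum_(k < n.+1) sqnorm (fcoef (ser (1 - (Cr u)%:P * 'X) * g) k) =
  \sum_(k < n.+1) sqnorm (fcoef (ser ('X - (Cr u)%:P) * g) k) +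
  (1 - u ^+ 2) * sqnorm (fcoef g n).
Proof.
elim: n => [|n IH].
  rewrite !big_ord_recr !big_ord0 /= fcoef_1subCX_mul fcoef_XsubC_mul; case: (fcoef g 0) => x y.
  by rewrite /sqnorm /=; ring.
rewrite big_ord_recr /= IH [in RHS]big_ord_recr /= fcoef_1subCX_mul fcoef_XsubC_mul.
case: (fcoef g n) (fcoef g n.+1) => x y [z w]; rewrite /sqnorm /=; ring.
Qed.

(** The partial sums increase, so the bound may be checked at large indices, where decay makes the
    boundary term arbitrarily small. *)
Lemma sqnorm_decay_blaschke (u K : R) g : 0 < u < 1 -> fps_decay g ->
  (forall n, \sum_(k < n) sqnorm (fcoef (ser ('X - (Cr u)%:P) * g) k) <= K) ->
  forall n, \sum_(k < n) sqnorm (fcoef (ser (1 - (Cr u)%:P * 'X) * g) k) <= K.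
Proof.
move=> /andP[u0 u1] dg hK n; have [M hM] := dg 1%N.
have mono m : (n <= m)%N ->
    \sum_(k < n) sqnorm (fcoef (ser (1 - (Cr u)%:P * 'X) * g) k) <=
    \sum_(k < m) sqnorm (fcoef (ser (1 - (Cr u)%:P * 'X) * g) k).
  move=> nm; rewrite -!(big_mkord xpredT (fun k => sqnorm (fcoef _ k))).
  rewrite (@big_cat_nat _ _ _ n 0 m) //= lerDl.
  by apply: sumr_ge0 => i _; apply: sqnorm_ge0.
apply/ler_addgt0Pr => eps e0.
have M0 : 0 <= M by apply: le_trans (hM 0); rewrite expr1n mulr1 sqnorm_ge0.
have [m hm] : exists m, M / eps < m%:R.
  by exists (Num.bound (M / eps)); apply: archi_boundP; rewrite divr_ge0 // ltW.
apply: le_trans (mono (maxn n m).+1 _) _; first by rewrite leqW // leq_maxl.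
rewrite sqnorm_blaschke lerD //.
apply: le_trans (_ : sqnorm (fcoef g (maxn n m)) <= _).
  rewrite ler_piMl ?sqnorm_ge0 // gerBl sqr_ge0 //.
have m0 : 0 < (maxn n m).+1%:R :> R by rewrite ltr0n.
have := hM (maxn n m); rewrite expr1 -ler_pdivlMr // => /le_trans; apply.
rewrite ler_pdivrMr // mulrC -ler_pdivrMr //; apply: le_trans (ltW hm) _.
by rewrite ler_nat leqW // leq_maxr.
Qed.

Lemma fps_XsubC_inj (z : C) g : z != 0 -> ser ('X - z%:P) * g = 0 -> g = 0.
Proof.
move=> z0 hg; have e k : (if k is j.+1 then fcoef g j else 0) = z * fcoef g k.
  by apply/eqP; rewrite -subr_eq0 -fcoef_XsubC_mul hg fcoef0.
apply: fpsP => k; rewrite fcoef0; apply: (mulfI z0); rewrite mulr0 -e.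
by elim: k => // k IH; apply: (mulfI z0); rewrite mulr0 -e.
Qed.

(* Each step divides [b] by the Blaschke factor [(X - u) / (1 - u X)], which
   preserves the l^2 norm of the coefficients and lowers the local exponent
   [- lam] at the regular singular point [u] by one. *)
Lemma ode_blaschke_bound (u K : R) (m : nat) :
  0 < u < 1 -> forall (G W : {poly C}) (lam : R) b,
  0 < lam -> G.[Cr u] != 0 -> fps_decay b ->
  (forall n, \sum_(k < n) sqnorm (fcoef b k) <= K) ->
  ser ('X - (Cr u)%:P) * (ser G * fps_deriv b - ser W * b) =
    - (ser (Cr lam)%:P * (ser G * b)) ->
  sqnorm (fcoef b 0) <= K * u ^+ (m.*2).
Proof.
move=> hu; have /andP[u0 u1] := hu.
elim: m => [|m IH] G W lam b lam0 G0 db hK ode.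
  by rewrite mulr1; have := hK 1%N; rewrite big_ord1.
have [G1 hG1] : exists G1, G - (G.[Cr u])%:P = G1 * ('X - (Cr u)%:P).
  by apply/factor_theorem; rewrite rootE !hornerE subrr.
have cu0 : Cr u != 0 by rewrite fmorph_eq0 gt_eqF.
have clam0 : Cr lam != 0 by rewrite fmorph_eq0 gt_eqF.
set L := 'X - (Cr u)%:P in ode hG1 *.
set B := 1 - (Cr u)%:P * 'X.
pose chi := ser G * fps_deriv b - ser W * b.
(* Formal division by [X - u] is always possible as [u] is nonzero; what matters is that this
   expression, solved from the equation, shows that the quotient decays. *)
pose b1 := ser (- (Cr lam * G.[Cr u])^-1)%:P * (chi + ser (Cr lam)%:P * (ser G1 * b)).
have dchi : fps_decay chi.
  apply: fps_decayD; first exact/fps_decay_poly/fps_decay_deriv.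
  exact/fps_decayN/fps_decay_poly.
have db1 : fps_decay b1.
  by apply/fps_decay_scale/fps_decayD/fps_decay_scale/fps_decay_poly.
have eb : b = ser L * b1.
  have eG : ser G1 * ser L = ser G - ser (G.[Cr u])%:P by rewrite -rmorphM -hG1 rmorphB.
  have eI : ser (- (Cr lam * G.[Cr u])^-1)%:P * ser (Cr lam)%:P * ser (G.[Cr u])%:P = -1.
    by rewrite -!rmorphM /= -mulrA mulNr mulVf ?mulf_neq0 // polyCN rmorphN rmorph1.
  exact: ode_divide eI ode eG.
have derL : fps_deriv (ser L) = 1.
  by rewrite fps_deriv_poly /L derivB derivX derivC subr0 rmorph1.
pose chi1 := ser G * fps_deriv b1 - ser W * b1.
have ode1 : ser L * chi1 = - (ser (Cr (lam + 1))%:P * (ser G * b1)).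
  apply/eqP; rewrite -subr_eq0; apply/eqP; apply: (fps_XsubC_inj cu0).
  have e1 : ser (Cr (lam + 1))%:P = ser (Cr lam)%:P + 1.
    have -> : Cr (lam + 1) = Cr lam + 1 by rewrite rmorphD rmorph1.
    by rewrite polyCD polyC1 [LHS]rmorphD; congr (_ + _); exact: rmorph1.
  move: ode; rewrite eb fps_derivM => ode; exact: ode_shift derL e1 ode.
pose b2 := ser B * b1.
have ode2 : ser L * (ser (G * B) * fps_deriv b2 - ser (G * B^`() + W * B) * b2) =
    - (ser (Cr (lam + 1))%:P * (ser (G * B) * b2)).
  rewrite /b2 fps_derivM fps_deriv_poly.
  have -> : ser (G * B) = ser G * ser B := rmorphM _ _ _.
  have -> : ser (G * B^`() + W * B) = ser G * ser B^`() + ser W * ser B.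
    by rewrite rmorphD !rmorphM.
  exact: ode_twist ode1.
have := IH (G * B) (G * B^`() + W * B) (lam + 1) b2.
(* The Blaschke factor has value [- u] at 0, so each step gains a factor [u ^+ 2]. *)
have -> : sqnorm (fcoef b 0) = u ^+ 2 * sqnorm (fcoef b2 0).
  rewrite eb /b2 fcoef_XsubC_mul fcoef_1subCX_mul mulr0 subr0 sub0r.
  by case: (fcoef b1 0) => x y; rewrite /sqnorm /=; ring.
rewrite doubleS -(addn2 m.*2) exprD => h.
rewrite mulrA [leRHS]mulrC ler_wpM2l ?sqr_ge0 //; apply: h => //.
- by rewrite addr_gt0.
- rewrite hornerM mulf_neq0 // /B !hornerE -rmorphM -(rmorph1 Cr) -rmorphB.
  rewrite fmorph_eq0 subr_eq0 eq_sym lt_eqF // mulr_ilt1 // ltW //.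
- exact: fps_decay_poly.
- by apply: sqnorm_decay_blaschke => // n; rewrite -/L -eb.
Qed.

End Blaschke.

(** * The formal solution of [M phi' = V phi] *)

Section FormalSolution.
Variables (K : numFieldType) (M V : {poly K}).
Hypothesis M0 : M.[0] != 0.
Local Notation ser := (@fps_of_poly K).
Implicit Types (h G : {poly K}).

(* If [M phi' = V phi] then [(h phi / M^k)' = (ode_step k h) phi / M^(k+1)]. *)
Definition ode_step k h := M * h^`() - k%:R * (M^`() * h) + V * h.

Fixpoint ode_iter m k h := if m is m'.+1 then ode_iter m' k.+1 (ode_step k h) else h.

(* The Taylor series at 0 of [h phi / M^k], where [phi(0) = 1]. *)
Definition ode_series k h : fps K :=
  Fps (fun m => (ode_iter m k h).[0] / (M.[0] ^+ (k + m) * m`!%:R)).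

Lemma ode_stepD k h G : ode_step k (h + G) = ode_step k h + ode_step k G.
Proof. by rewrite /ode_step derivD; ring. Qed.

Lemma ode_iterD m k h G : ode_iter m k (h + G) = ode_iter m k h + ode_iter m k G.
Proof. by elim: m k h G => //= m IH k h G; rewrite ode_stepD IH. Qed.

Lemma ode_seriesD k h G : ode_series k (h + G) = ode_series k h + ode_series k G.
Proof. by apply: fpsP => m; rewrite fcoefD /fcoef /= ode_iterD hornerD mulrDl. Qed.

Lemma ode_iter_mul m k h : ode_iter m k.+1 (M * h) = M * ode_iter m k h.
Proof.
elim: m k h => //= m IH k h; rewrite -IH; congr ode_iter.
by rewrite /ode_step derivM [k.+1%:R]mulrSr; ring.
Qed.

Lemma ode_series_mul k h : ode_series k.+1 (M * h) = ode_series k h.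
Proof.
apply: fpsP => m; rewrite /fcoef /= ode_iter_mul hornerM addSn exprS -mulrA.
by rewrite invfM mulrACA divff // mul1r.
Qed.

Lemma ode_series_deriv k h : fps_deriv (ode_series k h) = ode_series k.+1 (ode_step k h).
Proof.
apply: fpsP => m; rewrite fcoef_deriv /fcoef /= addSnnS factS natrM.
rewrite -[LHS]mulr_natr.
have : m.+1%:R != 0 :> K by rewrite pnatr_eq0.
have : m`!%:R != 0 :> K by rewrite pnatr_eq0 -lt0n fact_gt0.
have := expf_neq0 (k + m.+1) M0.
move: (M.[0] ^+ _) m.+1%:R m`!%:R => x y z x0 z0 y0.
by field; rewrite x0 y0 z0.
Qed.

(** Induction on the coefficient index: the constant terms agree, and the higher coefficients are
    read off the derivatives of both sides. *)
Lemma ode_series_poly_mul G k h : ser G * ode_series k h = ode_series k (G * h).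
Proof.
apply: fpsP => m; elim: m k G h => [|m IH] k G h.
  by rewrite fcoefM0 fcoef_poly /fcoef /= hornerM !horner_coef0 mulrA.
apply: (mulIf (_ : m.+1%:R != 0)); first by rewrite pnatr_eq0.
rewrite !mulr_natr -!fcoef_deriv fps_derivM fps_deriv_poly !ode_series_deriv fcoefD.
rewrite !IH -fcoefD -(ode_series_mul k) -ode_seriesD; congr (fcoef (ode_series _ _) _).
by rewrite /ode_step derivM; ring.
Qed.

Lemma ode_seriesP : ser M * fps_deriv (ode_series 0 1) = ser V * ode_series 0 1.
Proof.
rewrite ode_series_deriv !ode_series_poly_mul ode_series_mul; congr ode_series.
by rewrite /ode_step derivC mulr0 mul0r subr0 add0r.
Qed.

End FormalSolution.

(** * No decaying solution at a pole *)

Section PoleContradiction.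
Variable R : realType.
Local Notation C := R[i].
Local Notation Cr := (real_complex R).
Local Notation ser := (@fps_of_poly C).

Lemma sum_inv_sqr_le n : \sum_(k < n.+1) (k.+1%:R ^- 2 : R) <= 2 - n.+1%:R^-1.
Proof.
elim: n => [|n IH]; first by rewrite big_ord_recr big_ord0 /= expr1n invr1; lra.
rewrite big_ord_recr /=; apply: le_trans (lerD IH (lexx _)) _.
have h1 : 0 < n.+1%:R :> R by rewrite ltr0n.
rewrite [n.+2%:R]mulrSr; move: n.+1%:R h1 => x h1.
have h2 : 0 < x + 1 by lra.
rewrite -subr_ge0.
have -> : 2 - (x + 1)^-1 - (2 - x^-1 + (x + 1) ^- 2) = x^-1 * (x + 1) ^- 2.
  have x0 := lt0r_neq0 h1; have y0 := lt0r_neq0 h2.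
  by field; rewrite x0 y0.
by rewrite divr_ge0 ?invr_ge0 ?exprn_ge0 ?ltW.
Qed.

Lemma fps_decay_l2 (b : fps C) : fps_decay b ->
  exists K : R, forall n, \sum_(k < n) sqnorm (fcoef b k) <= K.
Proof.
move=> hb; have [K h] := hb 2%N; exists (K * 2) => n.
have K0 : 0 <= K by apply: le_trans (h 0); rewrite expr1n mulr1 sqnorm_ge0.
apply: le_trans (_ : \sum_(k < n) K * k.+1%:R ^- 2 <= _).
  by apply: ler_sum => k _; have := h k; rewrite -ler_pdivlMr ?exprn_gt0 ?ltr0n.
rewrite -mulr_sumr ler_wpM2l //; case: n => [|n]; first by rewrite big_ord0.
by apply: le_trans (sum_inv_sqr_le n) _; rewrite gerBl invr_ge0.
Qed.

Lemma le_geom_eq0 (x K u : R) : 0 < u < 1 -> 0 <= x ->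
  (forall m, x <= K * u ^+ m.*2) -> x = 0.
Proof.
move=> /andP[u0 u1] x0 hx; apply/eqP; rewrite eq_le x0 andbT.
have [|M hM] := @bounded_exp_poly R 1 (u ^+ 2).
  by rewrite exprn_ge0 ?(ltW u0) //= exprn_ilt1 ?(ltW u0).
have K0 : 0 <= K by have := hx 0; rewrite mulr1; apply: le_trans.
have h m : x * m.+1%:R <= K * M.
  have := hM m; rewrite expr1 -exprM mul2n => h.
  apply: le_trans (ler_wpM2r _ (hx m)) _ => //.
  by rewrite -mulrA ler_wpM2l.
rewrite leNgt; apply/negP => xp.
have hKM : 0 <= K * M / x.
  by rewrite divr_ge0 //; apply: le_trans (h 0); rewrite mulr1.
have := archi_boundP hKM; rewrite ltr_pdivrMr // [_ * x]mulrC => h1.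
have := h (Num.bound (K * M / x)); rewrite leNgt => /negP; apply.
by apply: lt_le_trans h1 _; rewrite ler_pM2l // ler_nat.
Qed.

(** If [P = P0 L^n] and [Lk = L^(n-1)], the factor [Lk] splits off both sides of the equation; the
    term from differentiating [L^n] supplies the exponent [- al n]. *)
Lemma ode_cancel (A B : comNzRingType) (f : {rmorphism A -> B})
    (P0 dP0 Q dQ Lk L n al : A) (b db : B) :
  f (P0 * (L * Lk) * Q) * db =
    f (al * (P0 * (L * Lk) * dQ - (dP0 * (L * Lk) + P0 * (n * Lk)) * Q)) * b ->
  f Lk * (f L * (f (P0 * Q) * db - f (al * (P0 * dQ - dP0 * Q)) * b) +
    f (al * n) * (f (P0 * Q) * b)) = 0.
Proof.
move=> /eqP; rewrite -subr_eq0 => /eqP h; rewrite -[RHS]h.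
by rewrite !(rmorphM, rmorphD, rmorphN); ring.
Qed.

Lemma ode_no_pole (P Q : {poly C}) (alpha u : R) (b : fps C) :
  0 < alpha -> 0 < u < 1 -> P != 0 -> root P (Cr u) -> ~~ root Q (Cr u) ->
  fps_decay b ->
  ser (P * Q) * fps_deriv b = ser ((Cr alpha)%:P * (P * Q^`() - P^`() * Q)) * b ->
  fcoef b 0 = 0.
Proof.
move=> al0 hu Pn0 rP rQ db ode.
have [u0 u1] := andP hu.
have cu0 : Cr u != 0 by rewrite fmorph_eq0 gt_eqF.
(* The multiplicity of the root [u] of [P] is [k.+1], so the local exponent is
   [- alpha * k.+1%:R]. *)
have [[|k] [P0 + hP]] := multiplicity_XsubC P (Cr u); rewrite Pn0 /= => rP0.
  by move: rP; rewrite hP expr0 mulr1 (negPf rP0).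
set L := 'X - _ in hP.
have dP : P^`() = P0^`() * (L * L ^+ k) + P0 * (k.+1%:R%:P * L ^+ k).
  rewrite hP derivM deriv_exp derivB derivX derivC subr0 mul1r -exprS.
  by rewrite -mulr_natl polyC_natr.
have [K hK] := fps_decay_l2 db.
pose G := P0 * Q; pose W := (Cr alpha)%:P * (P0 * Q^`() - P0^`() * Q).
have G0 : G.[Cr u] != 0 by rewrite hornerM mulf_neq0.
have lam0 : 0 < alpha * k.+1%:R by rewrite mulr_gt0 // ltr0n.
have ode1 : ser ('X - (Cr u)%:P) * (ser G * fps_deriv b - ser W * b) =
    - (ser (Cr (alpha * k.+1%:R))%:P * (ser G * b)).
  apply/eqP; rewrite -addr_eq0; apply/eqP.
  have cancelX a j : ser (L ^+ j) * a = 0 -> a = 0.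
    elim: j a => [|j IH] a; first by rewrite expr0 rmorph1 mul1r.
    by rewrite exprS rmorphM -mulrA => /(fps_XsubC_inj cu0)/IH.
  apply: (cancelX _ k).
  have -> : (Cr (alpha * k.+1%:R))%:P = (Cr alpha)%:P * k.+1%:R%:P.
    by rewrite -polyCM rmorphM rmorph_nat.
  rewrite -/L; apply: (ode_cancel (f := ser)).
  by move: ode; rewrite dP {1 2}hP -/L exprS.
have h m := ode_blaschke_bound m hu lam0 G0 db hK ode1.
have := le_geom_eq0 hu (sqnorm_ge0 _) h.
move/eqP; rewrite sqnorm_normc sqrf_eq0 => /eqP; exact: Normc.eq0_normc.
Qed.

End PoleContradiction.

(** * Derivatives of a power of a rational function *)

Section Taylor.
Variable R : realType.

(* Repeated integration of [g m >= g m 0 >= 0], using [(g k)' = g k.+1]. *)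
Lemma taylor_coef_le (r : R) (g : nat -> R -> R) : 0 <= r ->
  (forall k t, 0 <= t <= r -> 0 <= g k t) ->
  (forall k t, 0 <= t <= r -> is_derive t 1 (g k) (g k.+1 t)) ->
  forall m, g m 0 * r ^+ m / m`!%:R <= g 0 r.
Proof.
move=> r0 gp gd m.
have incr (h dh : R -> R) : (forall t, 0 <= t <= r -> is_derive t 1 h (dh t)) ->
    (forall t, 0 <= t <= r -> 0 <= dh t) -> forall t, 0 <= t <= r -> h 0 <= h t.
  move=> hd dhp t tr; have /andP[t0 _] := tr.
  apply: (@ger0_derive1_le_cc R h 0 r) => //; rewrite ?in_itv /= ?lexx ?r0 //.
  - move=> x; rewrite in_itv /= => /andP[/ltW x0 /ltW xr].
    by have [] := hd x; rewrite ?x0.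
  - move=> x; rewrite in_itv /= => /andP[/ltW x0 /ltW xr].
    by have [|_ e] := hd x; rewrite ?x0 // derive1E e dhp // x0.
  - apply: derivable_within_continuous => x; rewrite in_itv /= => xr.
    by have [] := hd x xr.
(* Here [k] counts the integrations already performed. *)
suff key k t : (k <= m)%N -> 0 <= t <= r ->
    g m 0 * t ^+ k / k`!%:R <= g (m - k)%N t.
  by have := key m r (leqnn m); rewrite subnn; apply; rewrite r0 lexx.
elim: k t => [|k IH] t km tr.
  rewrite subn0 mulr1 divr1.
  apply: (incr _ (g m.+1)).
    exact: gp.
  exact: tr.
pose h s := g (m - k.+1)%N s - g m 0 * s ^+ k.+1 / k.+1`!%:R.
suff : h 0 <= h t.
  rewrite /h expr0n /= mulr0 mul0r subr0 -subr_ge0 => h0t.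
  rewrite -subr_ge0; apply: le_trans (gp (m - k.+1)%N 0 _) _; rewrite ?lexx //.
  by rewrite -subr_ge0.
apply: (incr _ (fun s => g (m - k)%N s - g m 0 * s ^+ k / k`!%:R)) => // s sr.
  have := gd (m - k.+1)%N s sr; rewrite -subSn // subSS => gd1.
  pose c := g m 0 / k.+1`!%:R.
  have -> : h = g (m - k.+1)%N - (c *: (id ^+ k.+1) : R -> R).
    apply/funext => x; rewrite /h /c !fctE; congr (_ - _); rewrite /GRing.scale /=; ring.
  apply: is_derive_eq; congr (_ - _); rewrite /c /GRing.scale /= mulr1.
  rewrite factS natrM; field.
  by rewrite pnatr_eq0 -lt0n fact_gt0 /= addrC natr1 pnatr_eq0.
by rewrite subr_ge0; apply: IH => //; apply: ltnW.
Qed.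

End Taylor.

Section LineDerivative.
Variables (R : realType) (n : nat).
Implicit Types (f : 'rV[R]_n -> R) (x v : 'rV[R]_n).

Lemma derive_line f x v : 'D_v f x = 'D_1 (fun h : R => f (h *: v + x)) (0 : R).
Proof.
have aux : (fun h : R => h^-1 *: ((f \o shift x) (h *: v) - f x)) =
    (fun h : R => h^-1 *: (((fun h : R => f (h *: v + x)) \o shift 0) (h *: 1) -
      f (0 *: v + x))).
  by apply/funext => h; rewrite /shift /= scale0r add0r addr0 [h *: 1]mulr1.
by rewrite /derive aux.
Qed.

Lemma is_derive_line f x v (t : R) : differentiable f (x - t *: v) ->
  is_derive t 1 (fun s : R => f (x - s *: v)) (- 'D_v f (x - t *: v)).
Proof.
move=> df.
have e : - 'D_v f (x - t *: v) = 'D_(- v) f (x - t *: v) by rewrite !deriveE // linearN.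
have aux : (fun h : R => h^-1 *: (((fun s : R => f (x - s *: v)) \o shift t) (h *: 1) -
     f (x - t *: v))) =
   (fun h : R => h^-1 *: ((f \o shift (x - t *: v)) (h *: - v) - f (x - t *: v))).
  apply/funext => h /=; congr (_ *: (f _ - _)).
  by rewrite /shift /= [h *: 1]mulr1 scalerDl scalerN opprD addrCA addrA.
split; first by rewrite /derivable aux; exact: diff_derivable.
by rewrite e /derive aux.
Qed.

End LineDerivative.

Section DirectionalDerivation.
Variables (R : realType) (n : nat).
Implicit Types (v x : 'rV[R]_n) (N : mpoly n R).

Definition mderiv_dir v N : mpoly n R := \sum_i v ord0 i *: mderiv i N.

Lemma horner_deriv_line_poly v x N :
  (line_poly N v x)^`().[0] = peval (mderiv_dir v N) x.
Proof.
have -> : line_poly N v x = affine_line idfun (v ord0) (x ord0) N by [].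
rewrite deriv_affine_line horner_sum /mderiv_dir /peval raddf_sum /=.
apply: eq_bigr => i _; rewrite hornerZ mevalZ horner_affine_line.
by congr (_ * mmap _ _ _); apply/funext => j; rewrite mulr0 add0r.
Qed.

Lemma mderiv_dirD v v' N : mderiv_dir (v + v') N = mderiv_dir v N + mderiv_dir v' N.
Proof.
by rewrite /mderiv_dir -big_split; apply: eq_bigr => i _; rewrite mxE scalerDl.
Qed.

Lemma mderiv_dir_add v N N' : mderiv_dir v (N + N') = mderiv_dir v N + mderiv_dir v N'.
Proof.
by rewrite /mderiv_dir -big_split; apply: eq_bigr => i _; rewrite mderivD scalerDr.
Qed.

Variables (p q : mpoly n R) (alpha : R).

(* On the cone [D_v (f N / (p q)^k) = f (cm_step v k N) / (p q)^(k+1)] for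
   [f = (q / p)^alpha]. *)
Definition cm_step v (k : nat) N :=
  p * q * mderiv_dir v N - k%:R * (mderiv_dir v (p * q) * N) +
  mpolyC n alpha * (p * mderiv_dir v q - mderiv_dir v p * q) * N.

(** The initial denominator is [(p q)^k]; as in [iter_derive], the last direction of the list acts
    first. *)
Fixpoint cm_iter (k : nat) N vs :=
  if vs is v :: vs' then cm_step v (k + size vs') (cm_iter k N vs') else N.

Lemma cm_stepD v k N N' : cm_step v k (N + N') = cm_step v k N + cm_step v k N'.
Proof. by rewrite /cm_step mderiv_dir_add; ring. Qed.

Lemma cm_step_dirD v v' k N : cm_step (v + v') k N = cm_step v k N + cm_step v' k N.
Proof. by rewrite /cm_step !mderiv_dirD; ring. Qed.

Lemma cm_iterD k N N' vs : cm_iter k (N + N') vs = cm_iter k N vs + cm_iter k N' vs.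
Proof. by elim: vs => //= v vs ->; rewrite cm_stepD. Qed.

Lemma cm_iter_rcons k N vs v :
  cm_iter k N (rcons vs v) = cm_iter k.+1 (cm_step v k N) vs.
Proof. by elim: vs => [|w vs IH] /=; rewrite ?addn0 // IH size_rcons addSnnS. Qed.

End DirectionalDerivation.

Section IteratedDerivatives.
Variables (R : realType).

Lemma derive_powR_quotient (P Q N : {poly R}) (alpha : R) (m : nat) :
  0 < alpha -> 0 < P.[0] -> 0 < Q.[0] ->
  'D_1 (fun h : R => (Q.[h] / P.[h]) `^ alpha * N.[h] / (P.[h] * Q.[h]) ^+ m) (0 : R) =
  (Q.[0] / P.[0]) `^ alpha *
  (P.[0] * Q.[0] * N^`().[0] - m%:R * ((P^`().[0] * Q.[0] + P.[0] * Q^`().[0]) * N.[0])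
   + alpha * (P.[0] * Q^`().[0] - P^`().[0] * Q.[0]) * N.[0])
  / (P.[0] * Q.[0]) ^+ m.+1.
Proof.
move=> al0 P0 Q0; have QP0 : 0 < Q.[0] / P.[0] by rewrite divr_gt0.
have dP := is_derive_poly P 0; have dQ := is_derive_poly Q 0.
have dN := is_derive_poly N 0.
have dVP := is_deriveV (lt0r_neq0 P0) dP.
have dA := is_deriveM dQ dVP.
have dp : is_derive ((horner Q * (fun h => P.[h]^-1)) 0) (1 : R) ((fun x : R => x `^ alpha))
    (alpha * (Q.[0] / P.[0]) `^ (alpha - 1)) by exact: is_derive1_powR.
have dpow := is_derive1_comp dp dA.
have dD := is_deriveX m (is_deriveM dP dQ).
have D0 : ((horner P * horner Q) ^+ m) 0 != 0.
  by rewrite exprfctE /= expf_neq0 // mulf_neq0 // lt0r_neq0.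
have dVD := is_deriveV (f := (horner P * horner Q) ^+ m) D0 dD.
have -> : (fun h : R => (Q.[h] / P.[h]) `^ alpha * N.[h] / (P.[h] * Q.[h]) ^+ m) =
   ((fun x : R => x `^ alpha) \o (horner Q * (fun h => P.[h]^-1))) * horner N *
     (fun h => (((horner P * horner Q) ^+ m) h)^-1).
  by apply/funext => h; rewrite !fctE.
rewrite (@derive_val _ _ _ _ _ _ _ (is_deriveM (is_deriveM dpow dN) dVD)).
rewrite exprfctE !mulrfctE /= /GRing.scale /=.
(* Writing the power as base times [a], the power with exponent [alpha - 1], makes both sides
   rational expressions. *)
have <- := mulr_powRB1 (ltW QP0) al0.
move: (_ `^ (alpha - 1)) => a.
have p0 := lt0r_neq0 P0; have q0 := lt0r_neq0 Q0.
have pm : (P.[0] * Q.[0]) ^+ m != 0 by rewrite expf_neq0 // mulf_neq0.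
case: m pm {dD D0 dVD} => [|m] pm.
  by rewrite !mul0r !expr0 expr1; field; rewrite p0 q0.
rewrite [m.+1.-1]/= !exprS; move: pm; rewrite exprS.
move: (_ ^+ m) (m.+1%:R : R) => e c; rewrite mulf_eq0 negb_or => /andP[_ e0].
by field; rewrite p0 q0 e0.
Qed.
End IteratedDerivatives.

(** * Completely monotone functions on a cone *)

Section CompletelyMonotone.
Variables (R : realType) (n : nat) (C : set 'rV[R]_n).
Hypothesis hC : open_convex_cone C.

Lemma cone_scale (t : R) x : 0 < t -> C x -> C (t *: x).
Proof. by case: hC => _ _ _; apply. Qed.

Lemma cone_add x y : C x -> C y -> C (x + y).
Proof.
move=> Cx Cy; have [_ _ cC _] := hC.
have h2 : 0 <= (2^-1 : R) <= 1 by rewrite invr_ge0 ler0n invf_le1 ?ler1n.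
have := cC x y (Itv01 (proj1 (andP h2)) (proj2 (andP h2))) (mem_set Cx) (mem_set Cy).
move=> /set_mem /(cone_scale (ltr0Sn R 1)).
by rewrite scalerDr !scalerA /= /unstable.onem mulfV // mulrBr mulfV // mulr1 addrK !scale1r.
Qed.

Variables (p q : mpoly n R) (alpha : R).
Hypothesis p_pos : forall x, C x -> 0 < peval p x.
Hypothesis q_pos : forall x, C x -> 0 < peval q x.
Hypothesis alpha_pos : 0 < alpha.
Let f x := (peval q x / peval p x) `^ alpha.
Local Notation cm_iter := (cm_iter p q alpha).
Local Notation cm_step := (cm_step p q alpha).

Lemma iter_derive_powR_quotient vs x : C x ->
  iter_derive vs f x =
    f x * peval (cm_iter 0 1 vs) x / (peval p x * peval q x) ^+ size vs.
Proof.
elim: vs x => [|v vs IH] x Cx.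
  by rewrite /= /peval rmorph1 mulr1 divr1.
have line0 (N : mpoly n R) : (line_poly N v x).[0] = peval N x.
  by rewrite horner_line_poly scale0r add0r.
(* The formula can be differentiated because [C] is open, so it holds on a neighbourhood of [x]. *)
have near_C : \near x, iter_derive vs f x =
    f x * peval (cm_iter 0 1 vs) x / (peval p x * peval q x) ^+ size vs.
  have [_ oC _ _] := hC.
  by have := open_nbhs_nbhs (conj oC Cx); apply: filterS => y; apply: IH.
rewrite [LHS](near_eq_derive v near_C) derive_line.
have -> : (fun h : R => f (h *: v + x) * peval (cm_iter 0 1 vs) (h *: v + x) /
     (peval p (h *: v + x) * peval q (h *: v + x)) ^+ size vs) =
   (fun h => ((line_poly q v x).[h] / (line_poly p v x).[h]) `^ alpha *
     (line_poly (cm_iter 0 1 vs) v x).[h] /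
     ((line_poly p v x).[h] * (line_poly q v x).[h]) ^+ size vs).
  by apply/funext => h; rewrite !horner_line_poly.
rewrite derive_powR_quotient ?line0 ?p_pos ?q_pos //.
rewrite !horner_deriv_line_poly /=; congr (_ * _ / _).
move: (cm_iter 0 1 vs) => N; rewrite /peval /cm_step mevalD mevalB !mevalM.
rewrite mevalC mevalB !mevalM rmorph_nat add0n; congr (_ - _ * (_ * _) + _).
have := horner_deriv_line_poly v x (p * q); rewrite /peval => <-.
have -> : line_poly (p * q) v x = line_poly p v x * line_poly q v x.
  exact: (rmorphM (affine_line (@idfun R) (v ord0) (x ord0))).
by rewrite derivM !hornerE !line0 !horner_deriv_line_poly.
Qed.

Hypothesis f_cm : completely_monotone C f.

Lemma cm_iter_sign vs x : (forall v, v \in vs -> C v) -> C x ->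
  0 <= (-1) ^+ size vs * peval (cm_iter 0 1 vs) x.
Proof.
move=> Cvs Cx; have [_ /(_ vs Cvs x Cx)] := f_cm.
rewrite iter_derive_powR_quotient //.
have e (s g m d : R) : s * (g * m / d) = (s * m) * (g / d) by ring.
rewrite e pmulr_lge0 // divr_gt0 ?powR_gt0 ?exprn_gt0 ?divr_gt0 ?mulr_gt0 //.
all: by rewrite ?p_pos ?q_pos.
Qed.

(** Along [- v] all derivatives are nonnegative, so each Taylor term at [E] is at most
    [f (E - r *: v)]; dividing by [f E] gives the constant. *)
Lemma cm_taylor_bound (r : R) E v : 0 < r -> C v -> C (E - r *: v) ->
  exists K, forall m, (-1) ^+ m * peval (cm_iter 0 1 (nseq m v)) E /
    ((peval p E * peval q E) ^+ m * m`!%:R) * r ^+ m <= K.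
Proof.
move=> r0 Cv CEr; have [fs fm] := f_cm.
have seg t : 0 <= t <= r -> C (E - t *: v).
  move=> /andP[t0]; rewrite le_eqVlt => /predU1P[->//|tr].
  have -> : E - t *: v = (E - r *: v) + (r - t) *: v.
    by rewrite scalerBl addrA subrK.
  by apply: cone_add => //; apply: cone_scale => //; rewrite subr_gt0.
have CE : C E by have := seg 0; rewrite scale0r subr0; apply; rewrite lexx ltW.
pose g m t := (-1) ^+ m * iter_derive (nseq m v) f (E - t *: v).
have gp m t : 0 <= t <= r -> 0 <= g m t.
  move=> tr; have := fm (nseq m v) _ _ (seg t tr); rewrite size_nseq; apply.
  by move=> w /nseqP[->].
have gd m t : 0 <= t <= r -> is_derive t 1 (g m) (g m.+1 t).
  move=> tr; have dl := is_derive_line (fs (nseq m v) _ (seg t tr)).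
  have -> : g m = (-1) ^+ m *: (fun s => iter_derive (nseq m v) f (E - s *: v)) by [].
  apply: is_derive_eq; rewrite /g exprS mulN1r mulNr /GRing.scale /= mulrN.
  by [].
exists (g 0%N r / f E) => m.
have fE : 0 < f E by rewrite powR_gt0 // divr_gt0 ?p_pos ?q_pos.
rewrite ler_pdivlMr //; apply: le_trans (taylor_coef_le (ltW r0) gp gd m).
rewrite /g scale0r subr0 iter_derive_powR_quotient // size_nseq.
rewrite le_eqVlt; apply/orP; left; apply/eqP; rewrite invfM; ring.
Qed.

End CompletelyMonotone.

(** * Zeros in the tube over the cone *)

Lemma ode_iter_lin (K : numFieldType) (M W h h1 h2 : {poly K}) a b m k :
  h = a%:P * h1 + b%:P * h2 ->
  (ode_iter M W m k h).[0] =
    a * (ode_iter M W m k h1).[0] + b * (ode_iter M W m k h2).[0].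
Proof.
have ode_iterC c g : ode_iter M W m k (c%:P * g) = c%:P * ode_iter M W m k g.
  elim: m k g => //= m' IH k' g; rewrite -IH; congr ode_iter.
  by rewrite /ode_step derivM derivC mul0r add0r; ring.
by move=> ->; rewrite ode_iterD !ode_iterC hornerD !hornerCM.
Qed.

Lemma normc_lin_le (R : realType) (z1 z2 x1 x2 : R[i]) (r a1 a2 : R) :
  Normc.normc z1 <= r -> Normc.normc z2 <= r ->
  Normc.normc x1 <= a1 -> Normc.normc x2 <= a2 ->
  Normc.normc (z1 * x1 + z2 * x2) <= r * (a1 + a2).
Proof.
have npos (x : R[i]) : 0 <= Normc.normc x by case: x => a b; rewrite sqrtr_ge0.
move=> *; apply: le_trans (le_normcD _ _) _.
by rewrite !Normc.normcM mulrDr; apply: lerD; apply: ler_pM.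
Qed.

Section Tube.
Variables (R : realType) (n : nat).
Local Notation Cr := (real_complex R).
Local Notation normc := Normc.normc.
Implicit Types (N p q : mpoly n R) (E w : 'rV[R]_n).

(** The line [E + t (z1 w1 + z2 w2)]. Separating multipliers from real directions lets derivatives
    along it be expanded in directions of the cone. *)
Definition complex_line (z1 z2 : R[i]) (w1 w2 E : 'rV[R]_n) :
    {rmorphism mpoly n R -> {poly R[i]}} :=
  affine_line Cr (fun i => z1 * Cr (w1 ord0 i) + z2 * Cr (w2 ord0 i))
    (fun i => Cr (E ord0 i)).

Variables (z1 z2 : R[i]) (w1 w2 E : 'rV[R]_n).
Local Notation line := (complex_line z1 z2 w1 w2 E).

Lemma complex_lineZ c N : line (c *: N) = (Cr c)%:P * line N.
Proof. by rewrite -mul_mpolyC rmorphM /= affine_lineC. Qed.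

Lemma deriv_complex_line N :
  (line N)^`() = z1%:P * line (mderiv_dir w1 N) + z2%:P * line (mderiv_dir w2 N).
Proof.
rewrite /= deriv_affine_line /mderiv_dir -/line !rmorph_sum !mulr_sumr -big_split.
apply: eq_bigr => i _; rewrite !complex_lineZ -mul_polyC polyCD !polyCM /=; ring.
Qed.

Lemma horner0_complex_line N : (line N).[0] = Cr (peval N E).
Proof.
rewrite /= horner_affine_line.
apply: (mpoly_rmorph_ext
  (f := mmap Cr (fun i => (z1 * Cr (w1 ord0 i) + z2 * Cr (w2 ord0 i)) * 0 + Cr (E ord0 i)))
  (g := Cr \o meval (E ord0))) => [c|i] /=; first by rewrite mmapC mevalC.
by rewrite mmapX mmap1U mevalXU mulr0 add0r.
Qed.

Variables (p q : mpoly n R) (alpha : R).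
Local Notation P := (line p).
Local Notation Q := (line q).
Local Notation V := ((Cr alpha)%:P * (P * Q^`() - P^`() * Q)).
Local Notation cm_iter := (cm_iter p q alpha).
Local Notation cm_step := (cm_step p q alpha).

Lemma ode_step_complex_line k N : ode_step (P * Q) V k (line N) =
  z1%:P * line (cm_step w1 k N) + z2%:P * line (cm_step w2 k N).
Proof.
have step w : line (cm_step w k N) = P * Q * line (mderiv_dir w N) -
    k%:R * (line (mderiv_dir w (p * q)) * line N) +
    (Cr alpha)%:P * (P * line (mderiv_dir w q) - line (mderiv_dir w p) * Q) * line N.
  by rewrite /cm_step !(rmorphB, rmorphD, rmorphM, rmorph_nat) /= affine_lineC.
have dPQ : (P * Q)^`() =
    z1%:P * line (mderiv_dir w1 (p * q)) + z2%:P * line (mderiv_dir w2 (p * q)).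
  by rewrite -deriv_complex_line rmorphM.
have := (deriv_complex_line p, deriv_complex_line q, deriv_complex_line N).
move=> dd; rewrite /ode_step dPQ !step !dd {dPQ step dd}.
move: (line p) (line q) (line N) (line (mderiv_dir w1 p)) (line (mderiv_dir w2 p)).
move: (line (mderiv_dir w1 q)) (line (mderiv_dir w2 q)).
move: (line (mderiv_dir w1 N)) (line (mderiv_dir w2 N)).
move: (line (mderiv_dir w1 (p * q))) (line (mderiv_dir w2 (p * q))).
move: z1%:P z2%:P (Cr alpha)%:P (k%:R : {poly R[i]}) => *.
ring.
Qed.

(** The derivative expands into mixed derivatives along [w1] and [w2] with multipliers of modulus at
    most [r ^+ m]. These all have the same sign, so their absolute values add up to the derivative
    along [w1 + w2]. *)
Lemma ode_iter_complex_line_le (r : R) m k N : 0 <= r ->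
  normc z1 <= r -> normc z2 <= r ->
  (forall ws, {subset ws <= [:: w1; w2]} ->
    0 <= (-1) ^+ (k + size ws) * peval (cm_iter k N ws) E) ->
  normc (ode_iter (P * Q) V m k (line N)).[0] <=
    r ^+ m * ((-1) ^+ (k + m) * peval (cm_iter k N (nseq m (w1 + w2))) E).
Proof.
move=> r0 hz1 hz2; elim: m k N => [|m IH] k N sgn.
  have := sgn [::] (fun _ h => False_ind _ (notF h)); rewrite /= addn0 => s0.
  rewrite mul1r horner0_complex_line /normc /= expr0n addr0 sqrtr_sqr.
  by rewrite -[leRHS]ger0_norm // normrM normrX normrN1 expr1n mul1r.
have sgn' w : w \in [:: w1; w2] -> forall ws, {subset ws <= [:: w1; w2]} ->
    0 <= (-1) ^+ (k.+1 + size ws) * peval (cm_iter k.+1 (cm_step w k N) ws) E.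
  move=> hw ws hws; rewrite -cm_iter_rcons addSnnS -(size_rcons ws w).
  by apply: sgn => v; rewrite mem_rcons inE => /predU1P[->//|/hws].
have h1 := IH k.+1 (cm_step w1 k N) (sgn' w1 (mem_head _ _)).
have h2 := IH k.+1 (cm_step w2 k N) (sgn' w2 (mem_last w1 [:: w2])).
have -> : ode_iter (P * Q) V m.+1 k (line N) =
    ode_iter (P * Q) V m k.+1 (ode_step (P * Q) V k (line N)) by [].
rewrite (ode_iter_lin _ _ _ _ (ode_step_complex_line k N)).
apply: le_trans (normc_lin_le hz1 hz2 h1 h2) _.
have -> : cm_iter k N (nseq m.+1 (w1 + w2)) =
    cm_iter k.+1 (cm_step w1 k N) (nseq m (w1 + w2)) +
    cm_iter k.+1 (cm_step w2 k N) (nseq m (w1 + w2)).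
  rewrite -cm_iterD -cm_step_dirD -cm_iter_rcons.
  have -> // : forall (T : Type) (x : T) j, rcons (nseq j x) x = nseq j.+1 x.
  by move=> T x; elim=> //= j ->.
rewrite le_eqVlt; apply/orP; left; apply/eqP.
by rewrite /peval mevalD addSnnS [r ^+ m.+1]exprS; ring.
Qed.

End Tube.

Section TubeZeros.
Variables (R : realType) (n : nat) (C : set 'rV[R]_n).
Hypothesis hC : open_convex_cone C.
Variables (p q : mpoly n R) (alpha : R).
Hypothesis p_pos : forall x, C x -> 0 < peval p x.
Hypothesis q_pos : forall x, C x -> 0 < peval q x.
Hypothesis alpha_pos : 0 < alpha.
Hypothesis f_cm : completely_monotone C
  (fun x => (peval q x / peval p x) `^ alpha).
Local Notation Cr := (real_complex R).
Local Notation normc := Normc.normc.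

Lemma complex_line_zero (z1 z2 : R[i]) (w1 w2 E : 'rV[R]_n) (r r0 u : R) :
  0 < u < 1 -> C w1 -> C w2 -> 0 <= r < r0 -> C (E - r0 *: (w1 + w2)) ->
  normc z1 <= r -> normc z2 <= r ->
  root (complex_line z1 z2 w1 w2 E p) (Cr u) ->
  root (complex_line z1 z2 w1 w2 E q) (Cr u).
Proof.
move=> hu Cw1 Cw2 /andP[rge0 rr0] CE hz1 hz2 rp; apply: contraT => rq.
have r0gt0 : 0 < r0 by apply: le_lt_trans rr0.
have Cv : C (w1 + w2) by apply: cone_add.
have CEE : C E.
  by rewrite -(subrK (r0 *: (w1 + w2)) E); apply: cone_add => //; apply: cone_scale.
pose line := complex_line z1 z2 w1 w2 E; rewrite -/line in rp rq.
pose V := (Cr alpha)%:P * (line p * (line q)^`() - (line p)^`() * line q).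
pose b := ode_series (line p * line q) V 0 1.
have M0 : (line p * line q).[0] = Cr (peval p E * peval q E).
  by rewrite hornerM !horner0_complex_line rmorphM.
have pqE : 0 < peval p E * peval q E by rewrite mulr_gt0 ?p_pos ?q_pos.
have M0n0 : (line p * line q).[0] != 0 by rewrite M0 fmorph_eq0 gt_eqF.
have [K hK] := cm_taylor_bound hC p_pos q_pos alpha_pos f_cm r0gt0 Cv CE.
have sgn ws : {subset ws <= [:: w1; w2]} ->
    0 <= (-1) ^+ (0 + size ws) * peval (cm_iter p q alpha 0 1 ws) E.
  move=> hws; apply: (cm_iter_sign hC p_pos q_pos alpha_pos f_cm) => // v /hws.
  by rewrite !inE => /orP[]/eqP->.
(* The complex Taylor terms are dominated by those of the real direction [w1 + w2], which stay
   bounded at radius [r0]; since [r < r0], the bound is geometric. *)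
have hb m : normc (fcoef b m) <= K * (r / r0) ^+ m.
  have := ode_iter_complex_line_le m rge0 hz1 hz2 sgn.
  rewrite rmorph1 -/line -/V => hT.
  rewrite /fcoef /b /ode_series Normc.normcM Normc.normcV M0.
  have -> : Cr (peval p E * peval q E) ^+ (0 + m) * m`!%:R =
      Cr ((peval p E * peval q E) ^+ m * m`!%:R).
    by rewrite [RHS]rmorphM rmorphXn rmorph_nat.
  have Dgt0 : 0 < (peval p E * peval q E) ^+ m * m`!%:R.
    by rewrite mulr_gt0 ?exprn_gt0 // ltr0n fact_gt0.
  have -> : normc (Cr ((peval p E * peval q E) ^+ m * m`!%:R)) =
      (peval p E * peval q E) ^+ m * m`!%:R.
    by rewrite /normc /= expr0n addr0 sqrtr_sqr ger0_norm // ltW.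
  rewrite ler_pdivrMr //; apply: le_trans hT _.
  have := hK m; rewrite -ler_pdivlMr ?exprn_gt0 // ler_pdivrMr // => hKm.
  rewrite expr_div_n [K * _]mulrCA -[r ^+ m * _ * _]mulrA.
  by rewrite ler_wpM2l ?exprn_ge0 // add0n mulrAC [r0 ^- m * _]mulrC.
have rho1 : 0 <= r / r0 < 1 by rewrite divr_ge0 ?(ltW r0gt0) //= ltr_pdivrMr // mul1r.
have db : fps_decay b.
  apply: (@fps_decay_geom _ b (K ^+ 2) ((r / r0) ^+ 2)) => [|m].
    by have /andP[h0 h1] := rho1; rewrite exprn_ge0 //= exprn_ilt1.
  rewrite sqnorm_normc -exprM mulnC exprM -exprMn.
  rewrite lerXn2r ?hb ?nnegrE //; last first.
    by apply: le_trans (hb m); case: (fcoef b m) => x y; rewrite sqrtr_ge0.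
  by case: (fcoef b m) => x y; rewrite sqrtr_ge0.
have b0 : fcoef b 0 = 1.
  by rewrite /fcoef /= hornerC expr0 mulr1 divr1.
have Pn0 : line p != 0.
  apply: contraNneq M0n0 => ->; by rewrite mul0r horner0.
have := ode_no_pole alpha_pos hu Pn0 rp rq db (ode_seriesP V M0n0).
by rewrite b0 => /eqP; rewrite oner_eq0.
Qed.

(* With [w = e + y / M] and [w' = e - y / M], the segment from [(1 + N) e] to
   [e + i y] has direction [z w + z^* w'], where [|z|] is close to
   [(N^2 + M^2)^(1/2) / 2]; for [N = M^2] this is below [(1 + N) / 2]. *)
Lemma tube_zero (e y : 'rV[R]_n) : C e ->
  mmap Cr (fun i => Cr (e ord0 i) + 'i%C * Cr (y ord0 i)) p = 0 ->
  mmap Cr (fun i => Cr (e ord0 i) + 'i%C * Cr (y ord0 i)) q = 0.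
Proof.
move=> Ce.
have [M [M0 Cp Cm]] : exists M : R, [/\ 0 < M, C (e + M^-1 *: y) & C (e - M^-1 *: y)].
  have cvg (w : 'rV[R]_n) : \forall t \near (0 : R), C (e + t *: w).
    have h : (fun t : R => e + t *: w) @ (0 : R) --> e.
      rewrite -[X in _ --> X]addr0 -(scale0r w).
      by apply: cvgD; [exact: cvg_cst | apply: cvgZr_tmp; exact: cvg_id].
    have [_ oC _ _] := hC.
    exact: (h _ (open_nbhs_nbhs (conj oC Ce))).
  have /nbhs_ballP[eps /= eps0 heps] : nbhs (0 : R)
      ([set t | C (e + t *: y)] `&` [set t | C (e + t *: - y)]).
    by apply: filterI; apply: cvg.
  have [] := heps (eps / 2).
    rewrite /ball /= sub0r normrN gtr0_norm ?divr_gt0 //; lra.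
  by move=> h1 h2; exists (2 / eps); rewrite invf_div divr_gt0 // -scalerN.
pose N := M ^+ 2.
(* With [d = (2 * (N + 1))^-1], [u ^+ 2 * (N + 1)] equals [N + d ^+ 2 * (N + 1)]; exceeding [N] is
   exactly what makes [r < (1 + N) / 2]. *)
pose u := 1 - (2 * (N + 1))^-1.
(* Chosen so that the line from [(1 + N) *: e] reaches [e + i y] at parameter [u] rather than at
   1. *)
pose z1 := (- (N / (2 * u)) +i* (M / (2 * u)))%C.
pose z2 := (- (N / (2 * u)) -i* (M / (2 * u)))%C.
have N0 : 0 < N by rewrite exprn_gt0.
have N1 : 0 < N + 1 by rewrite addr_gt0.
have hd : 0 < (2 * (N + 1))^-1 < 1.
  by rewrite invr_gt0 mulr_gt0 //= invf_lt1 ?mulr_gt0 //; lra.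
have hu : 0 < u < 1 by rewrite /u; lra.
have /andP[u0 u1] := hu.
have hu2 : N < u ^+ 2 * (N + 1).
  rewrite /u; set d := (2 * (N + 1))^-1 in hd *.
  have ed : 2 * (N + 1) * d = 1 by rewrite mulfV // mulf_neq0 ?gt_eqF.
  have : 0 < d ^+ 2 * (N + 1) by rewrite mulr_gt0 ?exprn_gt0 //; case/andP: hd.
  nra.
pose r := Num.sqrt (N * (N + 1)) / (2 * u).
have r2 : r ^+ 2 = N * (N + 1) / (4 * u ^+ 2).
  rewrite /r expr_div_n sqr_sqrtr ?mulr_ge0 ?ltW //; congr (_ / _); ring.
have rge0 : 0 <= r by rewrite divr_ge0 ?sqrtr_ge0 // mulr_ge0 // ltW.
have rlt : r < (1 + N) / 2.
  suff : r ^+ 2 < ((1 + N) / 2) ^+ 2.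
    by rewrite ltr_pXn2r // nnegrE divr_ge0 // addr_ge0 // ltW.
  rewrite r2 ltr_pdivrMr ?mulr_gt0 ?exprn_gt0 //.
  have -> : ((1 + N) / 2) ^+ 2 * (4 * u ^+ 2) = (u ^+ 2 * (N + 1)) * (N + 1) by field.
  by rewrite ltr_pM2r.
have nz (x : R) : x ^+ 2 = M ^+ 2 -> normc (- (N / (2 * u)) +i* (x / (2 * u)))%C <= r.
  move=> x2; rewrite /normc /r; rewrite -[leRHS](@ger0_norm _ _ rge0) -sqrtr_sqr r2.
  rewrite ler_sqrt; last by rewrite ?ltW // divr_gt0 // mulr_gt0 // exprn_gt0.
  rewrite sqrrN !expr_div_n x2 -/N -mulrDl.
  have -> : (2 * u) ^+ 2 = 4 * u ^+ 2 by ring.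
  by have -> : N ^+ 2 + N = N * (N + 1) by ring.
have rootE (g : mpoly n R) :
    root (complex_line z1 z2 (e + M^-1 *: y) (e - M^-1 *: y) ((1 + N) *: e) g) (Cr u) =
    (mmap Cr (fun i => Cr (e ord0 i) + 'i%C * Cr (y ord0 i)) g == 0).
  have h : (complex_line z1 z2 (e + M^-1 *: y) (e - M^-1 *: y) ((1 + N) *: e) g).[Cr u] =
    mmap Cr _ g := horner_affine_line _ _ _ _ _.
  rewrite /root h {h}; set h1 := (fun i => _); set h2 := (fun i => _).
  suff -> : h1 = h2 by [].
  apply/funext => i; rewrite /h1 /h2 !mxE.
  apply/eqP; rewrite eq_complex /=; apply/andP; split; apply/eqP.
    by field; rewrite !gt_eqF.
  by field; rewrite !gt_eqF.
move=> hp; apply/eqP; rewrite -rootE.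
(* The larger radius is the midpoint of [r] and [(1 + N) / 2]; the two directions add up to [2 e],
   so the real endpoint is a positive multiple of [e]. *)
apply: (@complex_line_zero _ _ _ _ _ r ((r + (1 + N) / 2) / 2)) => //.
- by rewrite rge0 /=; lra.
- have -> : (1 + N) *: e - ((r + (1 + N) / 2) / 2) *: (e + M^-1 *: y + (e - M^-1 *: y)) =
      ((1 + N) / 2 - r) *: e.
    by apply/rowP => i; rewrite !mxE; field; rewrite gt_eqF.
  by apply: (cone_scale hC) => //; rewrite subr_gt0.
- exact: nz.
- have -> : z2 = (- (N / (2 * u)) +i* (- M / (2 * u)))%C by rewrite /z2 mulNr.
  by apply: nz; rewrite sqrrN.
by rewrite rootE hp.
Qed.
End TubeZeros.

(** * Hyperbolicity *)

(** Among [size g] distinct points of the interval, at least one is not a root. *)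
Lemma poly_neq0_point (K : numFieldType) (g : {poly K}) (eps : K) :
  g != 0 -> 0 < eps -> exists s, [/\ 0 < s, s < eps & g.[s] != 0].
Proof.
move=> g0 e0; pose pts := [seq eps / j.+2%:R | j <- iota 0 (size g)].
have inj : injective (fun j : nat => eps / j.+2%:R).
  move=> i j /(mulfI (lt0r_neq0 e0)) /invr_inj /eqP.
  by rewrite eqr_nat => /eqP[].
have : ~~ all (root g) pts.
  apply/negP => rg; have := max_poly_roots g0 rg.
  by rewrite map_inj_uniq // iota_uniq size_map size_iota ltnn => /(_ isT).
case/allPn => _ /mapP[j _ ->] rj; exists (eps / j.+2%:R); split=> //.
  by rewrite divr_gt0 // ltr0n.
by rewrite ltr_pdivrMr ?ltr0n // ltr_pMr // ltr1n.
Qed.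

(** If [c] vanishes everywhere, so do its partial derivatives. Differentiation lowers each monomial
    to the constant one, and the integer factors cancel in characteristic zero. *)
Lemma mpoly_neq0_point (K : numFieldType) (n : nat) (c : mpoly n K) :
  c != 0 -> exists x, meval x c != 0.
Proof.
move=> c0; apply: contrapT => h; move/eqP: c0; apply.
have {h} : forall x, meval x c = 0.
  by move=> x; apply/eqP; apply: contra_notT h => hx; exists x.
move=> h; apply/mpolyP => m; rewrite mcoeff0.
have [k] := ubnP (mdeg m); elim: k c h m => // k IH c h m.
have [->|] := eqVneq m mnm0 => [_|].
  rewrite -[RHS](h (fun=> 0)) (mpolyE c) !raddf_sum /=; apply: eq_bigr => l _.
  rewrite mcoeffZ mevalZ mcoeffX mevalX; congr (_ * _).
  have [->|l0] := eqVneq l mnm0.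
    by rewrite big1 // => i _; rewrite mnm0E.
  have [i li] : exists i, l i != 0%N.
    apply/existsP; apply: contraNT l0; rewrite negb_exists => /forallP l0.
    by apply/eqP/mnmP => i; rewrite mnm0E; apply/eqP; rewrite -[_ == _]negbK.
  by rewrite (bigD1 i) //= expr0n (negPf li) mul0r.
move=> m0; have [i mi] : exists i, m i != 0%N.
  apply/existsP; apply: contraNT m0; rewrite negb_exists => /forallP m0.
  by apply/eqP/mnmP => i; rewrite mnm0E; apply/eqP; rewrite -[_ == _]negbK.
have em : m = mnm_add (mnm_sub m (mnm1 i)) (mnm1 i).
  by apply/mnmP => j; rewrite mnmDE mnmBE mnm1E; case: eqP => [<-|_]; lia.
rewrite em mdegD mdeg1 addn1 ltnS => hm.
have hd x : meval x (mderiv i c) = 0.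
  pose a j : K := (j == i)%:R.
  have l0 : affine_line idfun a x c = 0.
    apply/eqP; apply: contraT => /poly_neq0_point /(_ ltr01)[s [_ _]].
    rewrite horner_affine_line; have := h (fun j => a j * s + x j).
    by rewrite /meval => ->; rewrite eqxx.
  have := deriv_affine_line idfun a x c; rewrite l0 deriv0 (bigD1 i) //= big1.
    rewrite addr0 /a eqxx scale1r => /(congr1 (fun P => P.[0])).
    rewrite horner0 horner_affine_line => ->.
    by congr mmap; apply/funext => j; rewrite mulr0 add0r.
  by move=> j /negPf ji; rewrite /a ji scale0r.
have := IH _ hd _ hm; rewrite mcoeff_mderiv => /eqP.
by rewrite -mulr_natr mulf_eq0 pnatr_eq0 orbF => /eqP.
Qed.

(** * Limits of real-rooted polynomials *)

Section RealRooted.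
Variable R : realType.
Local Notation Cr := (real_complex R).
Local Notation normc := Normc.normc.

Lemma normc_ge0 (z : R[i]) : 0 <= normc z.
Proof. by case: z => a b; rewrite sqrtr_ge0. Qed.

Lemma normc_real_complex (x : R) : normc (Cr x) = `|x|.
Proof. by rewrite /normc /= expr0n addr0 sqrtr_sqr. Qed.

(** After factoring over the complex numbers, each factor [z - x] with real [x] has modulus at least
    that of [Im z]. *)
Lemma real_rooted_lower_bound (P : {poly R}) (z : R[i]) : only_real_zeros P ->
  normc (Cr (lead_coef P)) * `|complex.Im z| ^+ (size P).-1 <=
    normc (map_poly Cr P).[z].
Proof.
move=> rP; have [->|P0] := eqVneq P 0.
  by rewrite lead_coef0 normc_real_complex normr0 mul0r normc_ge0.
have [s hs] := closed_field_poly_normal (map_poly Cr P).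
rewrite lead_coef_map in hs.
have sz : (size P).-1 = size s.
  rewrite -(size_map_poly Cr) hs size_scale ?fmorph_eq0 ?lead_coef_eq0 //.
  by rewrite size_prod_XsubC.
rewrite sz [in leRHS]hs hornerZ Normc.normcM ler_wpM2l ?normc_ge0 //.
rewrite horner_prod.
have sr x : x \in s -> complex.Im x = 0.
  move=> xs; apply: rP; rewrite hs rootZ ?root_prod_XsubC //.
  by rewrite fmorph_eq0 lead_coef_eq0.
elim: s sr {hs sz} => [|x s IH] sr; first by rewrite big_nil expr0 Normc.normc1.
rewrite big_cons Normc.normcM /= exprS ler_pM ?exprn_ge0 //; last first.
  by apply: IH => y ys; apply: sr; rewrite inE ys orbT.
rewrite !hornerE; have := sr x (mem_head _ _).
case: z x {IH sr} => a b [c d] /= ->; rewrite oppr0 addr0 -sqrtr_sqr ler_sqrt.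
  by rewrite lerDr sqr_ge0.
by rewrite addr_ge0 ?sqr_ge0.
Qed.

(** If [A] vanished at 0, it would be at most [K s] in modulus for small positive [s]; some such [s]
    avoids the roots of [g], against the lower bound. *)
Lemma poly_continuous_at0 (A : {poly R[i]}) (g : {poly R}) (delta : R) :
  0 < delta -> g != 0 ->
  (forall s : R, g.[s] != 0 -> delta <= normc A.[Cr s]) -> A.[0] != 0.
Proof.
move=> d0 g0 hA; apply/negP => /factor_theorem[B hB].
have [K [K0 hK]] : exists K, 0 < K /\ forall s, 0 < s < 1 -> normc B.[Cr s] <= K.
  elim/poly_ind: B {hB} => [|B c [K [K0 hK]]].
    by exists 1; split=> // s _; rewrite horner0 Normc.normc0.
  exists (K + normc c); split; first by rewrite ltr_pwDl // normc_ge0.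
  move=> s hs; have /andP[s0 s1] := hs; rewrite !hornerE.
  apply: le_trans (le_normcD _ _) _; rewrite lerD2r Normc.normcM.
  rewrite normc_real_complex gtr0_norm // -[leRHS]mulr1.
  by apply: ler_pM; rewrite ?normc_ge0 ?hK // ltW.
have [|s [s0 s1 gs]] := @poly_neq0_point R g (Num.min 1 (delta / K)) g0.
  by rewrite lt_min ltr01 divr_gt0.
move: s1; rewrite lt_min => /andP[s1 sK].
have := hA s gs; rewrite hB hornerM Normc.normcM !hornerE.
rewrite subr0 normc_real_complex gtr0_norm // leNgt => /negP; apply.
apply: le_lt_trans (_ : K * s < _).
  by rewrite ler_wpM2r ?(ltW s0) // hK // s0.
by rewrite mulrC -ltr_pdivlMr.
Qed.

End RealRooted.

Section Hyperbolicity.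
Variables (R : realType) (n : nat) (p q : mpoly n R) (e : 'rV[R]_n) (d : nat).
Local Notation Cr := (real_complex R).
Local Notation normc := Normc.normc.
Hypothesis hp : p \is ishomog1 d mdeg.
Hypothesis hpq : mpoly_coprime p q.
Hypothesis pe : 0 < peval p e.

Lemma horner_map_line_poly N x t : (map_poly Cr (line_poly N e x)).[t] =
  mmap Cr (fun i => Cr (e ord0 i) * t + Cr (x ord0 i)) N.
Proof.
have -> : line_poly N e x = affine_line idfun (e ord0) (x ord0) N by [].
apply: (mpoly_rmorph_ext
  (f := horner_eval t \o map_poly Cr \o affine_line idfun (e ord0) (x ord0))) => [c|i] /=.
  by rewrite affine_lineC map_polyC mmapC /horner_eval hornerC.
rewrite affine_lineX mmapX mmap1U /horner_eval rmorphD /= map_polyC.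
by rewrite linearZ /= map_polyX !hornerE.
Qed.

Lemma size_line_poly_homog x : size (line_poly p e x) = d.+1.
Proof.
have ec : (line_poly p e x)`_d = peval p e.
  exact: (coef_affine_line_homog (@idfun R) (e ord0) (x ord0) hp).
apply/eqP; rewrite eqn_leq.
have -> /= : (size (line_poly p e x) <= d.+1)%N.
  exact: (size_affine_line_homog (@idfun R) (e ord0) (x ord0) hp).
by rewrite ltnNge; apply/negP => /leq_sizeP/(_ d (leqnn d)) /eqP; rewrite ec gt_eqF.
Qed.

Lemma lead_coef_line_poly_homog x : lead_coef (line_poly p e x) = peval p e.
Proof.
rewrite lead_coefE size_line_poly_homog.
exact: (coef_affine_line_homog (@idfun R) (e ord0) (x ord0) hp).
Qed.

(* The coefficients of [p] on the lines through [x] with direction [e] depend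
   polynomially on [x], so real-rootedness for generic [x] passes to all [x]. *)
Lemma real_zeros_of_generic :
  (forall x, (forall z, root (map_poly Cr (line_poly p e x)) z ->
                 ~~ root (map_poly Cr (line_poly q e x)) z) ->
     only_real_zeros (line_poly p e x)) ->
  forall x, only_real_zeros (line_poly p e x).
Proof.
move=> gen x0 t0 rt0; apply/eqP; apply: contraT => im0.
have [c [c0 hc]] := generic_line_no_common_root hpq hp (lt0r_neq0 pe).
have [x1 hx1] := mpoly_neq0_point c0.
pose X1 : 'rV[R]_n := \row_i x1 i.
(* The generic condition [c] along the segment from [x0] to [X1]; it is a nonzero polynomial since
   its value at 1 is that of [c] at [X1]. *)
pose g := line_poly c (X1 - x0) x0.
pose A := affine_line Cr (fun i => Cr ((X1 - x0) ord0 i))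
   (fun i => Cr (e ord0 i) * t0 + Cr (x0 ord0 i)) p.
have hA s : A.[Cr s] = (map_poly Cr (line_poly p e (x0 + s *: (X1 - x0)))).[t0].
  rewrite /A horner_affine_line horner_map_line_poly; congr mmap.
  apply/funext => i; rewrite !mxE !(rmorphD, rmorphM, rmorphN) /=; ring.
(* This lower bound for [p] at [t0] is uniform over generic base points, since degree and leading
   coefficient on the line do not depend on the base point. *)
have delta0 : 0 < peval p e * `|complex.Im t0| ^+ d.
  by rewrite mulr_gt0 // exprn_gt0 // normr_gt0.
have g0 : g != 0.
  apply: contraNneq hx1 => g0; have := horner_line_poly c (X1 - x0) x0 1.
  rewrite -/g g0 horner0 scale1r subrK => /esym; rewrite /peval.
  have -> : X1 ord0 = x1 by apply/funext => i; rewrite mxE.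
  by move=> ->.
have := @poly_continuous_at0 R A g _ delta0 g0; rewrite -(rmorph0 Cr) hA scale0r addr0.
move: rt0; rewrite /root => -> /=; apply => s gs.
rewrite hA; set x := x0 + _.
have rx : only_real_zeros (line_poly p e x).
  apply: gen => z rp; apply/negP => rq; move/eqP: gs; apply.
  rewrite /g horner_line_poly addrC -/x.
  apply: (fmorph_inj Cr); rewrite rmorph0; apply: (hc _ Cr (x ord0) z).
    by rewrite -horner_map_line_poly; apply/rootP.
  by rewrite -horner_map_line_poly; apply/rootP.
have := real_rooted_lower_bound t0 rx.
by rewrite size_line_poly_homog lead_coef_line_poly_homog normc_real_complex gtr0_norm.
Qed.

End Hyperbolicity.

Lemma convex_sub_component (R : realType) (n : nat) (C A : set 'rV[R]_n) e :
  open_convex_cone C -> C e -> C `<=` A -> C `<=` connected_component A e.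
Proof.
move=> hC Ce CA y Cy.
pose g (t : R) := e + t *: (y - e).
have gc : continuous g.
  by move=> t; apply: cvgD; [exact: cvg_cst | apply: cvgZr_tmp; exact: cvg_id].
have h : g @` `[0, 1] `<=` connected_component A e.
  apply: connected_component_max.
  - by exists 0; rewrite /g /= ?scale0r ?addr0 // in_itv /= lexx ler01.
  - move=> _ [t /= + <-]; rewrite in_itv /= => /andP[t0 t1]; apply: CA.
    have -> : g t = (1 - t) *: e + t *: y.
      rewrite /g scalerBr scalerBl scale1r addrCA addrA [t *: y + _]addrC.
      by rewrite -!addrA [- _ + _]addrC.
    (* The endpoints are separate because the cone is closed only under positive scaling. *)
    have [->|tn0] := eqVneq t 0; first by rewrite subr0 scale1r scale0r addr0.
    have [->|tn1] := eqVneq t 1; first by rewrite subrr scale0r scale1r add0r.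
    apply: (cone_add hC); apply: (cone_scale hC) => //.
      by rewrite subr_gt0 lt_neqAle tn1.
    by rewrite lt_neqAle eq_sym tn0.
  - apply: connected_continuous_connected; first exact: segment_connected.
    exact: continuous_subspaceT.
apply: h; exists 1; first by rewrite /= in_itv /= lexx ler01.
by rewrite /g scale1r addrC subrK.
Qed.

Unset Implicit Arguments.
Set Strict Implicit.

Theorem theorem3p16 (R : realType) (n : nat) (C : set 'rV[R]_n)
    (p q : mpoly n R) (alpha : R)
    (hC : open_convex_cone C)
    (hp : p \is ishomog mdeg) (hq : q \is ishomog mdeg)
    (hpq : mpoly_coprime p q)
    (p_pos : forall x, C x -> 0 < peval p x)
    (q_pos : forall x, C x -> 0 < peval q x)
    (alpha_pos : 0 < alpha)
    (f_cm : completely_monotone C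
              (fun x => (peval q x / peval p x) `^ alpha)) :
  exists e : 'rV[R]_n, hyperbolic p e /\ C `<=` hyperbolicity_cone p e.
Proof.
have [[e Ce] _ _ _] := hC; exists e; split; last first.
  by apply: (convex_sub_component hC Ce) => x Cx; rewrite /= gt_eqF ?p_pos.
split=> //; first exact: p_pos.
have hp1 : p \is ishomog1 (mmeasure mdeg p).-1 mdeg := hp.
have hq1 : q \is ishomog1 (mmeasure mdeg q).-1 mdeg := hq.
apply: (real_zeros_of_generic hp1 hpq (p_pos e Ce)) => x nocommon z rz.
apply/eqP; apply: contraT => im0.
have := nocommon z rz; rewrite /root horner_map_line_poly => /negP[].
move: rz; rewrite /root horner_map_line_poly.
(* With this [c] and [y], [z e + x = c (e + i y)]; by homogeneity a nonreal zero on the line becomes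
   a zero in the tube over [C], hence a common zero of [p] and [q]. *)
pose c := ('i%C * real_complex R (complex.Im z))%R.
pose y : 'rV[R]_n := - (complex.Im z)^-1 *: (complex.Re z *: e + x).
have -> : (fun i => real_complex R (e ord0 i) * z + real_complex R (x ord0 i)) =
    (fun i => c * (real_complex R (e ord0 i) + 'i%C * real_complex R (y ord0 i))).
  apply/funext => i; rewrite /c /y !mxE; case: z im0 {c y} => a b /= b0.
  by apply/eqP; rewrite eq_complex /=; apply/andP; split; apply/eqP; field.
have c0 : c != 0.
  rewrite mulf_neq0 ?fmorph_eq0 // eq_complex /= oner_eq0 andbF //.
rewrite (mmap_homog _ _ hp1) (mmap_homog _ _ hq1) !mulf_eq0 !expf_eq0 (negPf c0).
rewrite !andbF /= => /eqP pz; apply/eqP.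
exact: (tube_zero hC p_pos q_pos alpha_pos f_cm Ce pz).
Qed.
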